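(* Let $\mathscr{P}_i=(a_i,b_i,c_i,d_i,e_i)$, $i=1,\dots,6$, be parameters with $a_i+b_i+c_i+d_i+e_i=0$. Then the operators $R(\mathscr{P}_i,\mathscr{P}_j,\mathscr{P}_k)_{ijk}$ defined in the context satisfy the tetrahedron equation $$R(\mathscr{P}_1,\mathscr{P}_2,\mathscr{P}_4)_{124}\,R(\mathscr{P}_1,\mathscr{P}_3,\mathscr{P}_5)_{135}\,R(\mathscr{P}_2,\mathscr{P}_3,\mathscr{P}_6)_{236}\,R(\mathscr{P}_4,\mathscr{P}_5,\mathscr{P}_6)_{456}$$ $$=R(\mathscr{P}_4,\mathscr{P}_5,\mathscr{P}_6)_{456}\,R(\mathscr{P}_2,\mathscr{P}_3,\mathscr{P}_6)_{236}\,R(\mathscr{P}_1,\mathscr{P}_3,\mathscr{P}_5)_{135}\,R(\mathscr{P}_1,\mathscr{P}_2,\mathscr{P}_4)_{124}.$$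
   Context: Let $q=\mathrm{e}^{\hbar}$ be generic. Let $\mathsf{u}_i,\mathsf{w}_i$ ($i=1,\dots,6$) be canonical variables with $[\mathsf{u}_i,\mathsf{w}_j]=\hbar\delta_{ij}$, $[\mathsf{u}_i,\mathsf{u}_j]=[\mathsf{w}_i,\mathsf{w}_j]=0$; their exponentials generate a product of $q$-Weyl algebras, $\mathrm{e}^{\mathsf{u}_i}\mathrm{e}^{\mathsf{w}_j}=q^{\delta_{ij}}\mathrm{e}^{\mathsf{w}_j}\mathrm{e}^{\mathsf{u}_i}$. The quantum dilogarithm is $\Psi_q(Y)=1/(-qY;q^2)_\infty$, $(z;q)_\infty=\prod_{n\ge0}(1-zq^n)$, with expansions $\Psi_q(Y)=\sum_{n\ge0}\frac{(-qY)^n}{(q^2;q^2)_n}$ and $\Psi_q(Y)^{-1}=\sum_{n\ge0}\frac{q^{n^2}Y^n}{(q^2;q^2)_n}$. $N_6$ is the group generated by $\mathrm{e}^{\pm\frac1\hbar\mathsf{u}_i\mathsf{w}_j}$ ($i\ne j$), $\mathrm{e}^{\frac a\hbar\mathsf{u}_i}$, $\mathrm{e}^{\frac a\hbar\mathsf{w}_i}$ ($a\in\mathbb{C}$) and $b\in\mathbb{C}^\times$, $i,j\in\{1,\dots,6\}$, with multiplication given by the Baker–Campbell–Hausdorff formula and the commutation relations $[\mathsf{u}_i,\mathsf{w}_j]=\hbar\delta_{ij}$, $[\mathsf{u}_i,\mathsf{u}_j]=[\mathsf{w}_i,\mathsf{w}_j]=0$. The symmetric group $\mathfrak{S}_6$,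 generated by transpositions $\rho_{ij}$, acts on it by permuting the indices of the canonical variables (and acts trivially on the parameters). For indices $i,j,k$ put $\lambda_0=\frac{e_j-e_k}{2}$, $\lambda_1=a_j-a_k+b_j-b_k+\lambda_0$, $\lambda_2=-a_i-b_j+b_k-\lambda_0$, $\lambda_3=c_i-c_j+c_k$, and $$P_{ijk}=\mathrm{e}^{\frac1\hbar(\mathsf{u}_k-\mathsf{u}_j)\mathsf{w}_i}\,\mathrm{e}^{\frac{\lambda_0}{\hbar}(-\mathsf{w}_i-\mathsf{w}_j+\mathsf{w}_k)}\,\mathrm{e}^{\frac1\hbar(\lambda_1\mathsf{u}_i+\lambda_2\mathsf{u}_j+\lambda_3\mathsf{u}_k)}\,\rho_{jk}\in N_6\rtimes\mathfrak{S}_6 .$$ Define $$R(\mathscr{P}_i,\mathscr{P}_j,\mathscr{P}_k)_{ijk}=\Psi_q(\mathrm{e}^{-d_i-c_j-b_k+\mathsf{u}_i+\mathsf{u}_k+\mathsf{w}_i-\mathsf{w}_j+\mathsf{w}_k})^{-1}\Psi_q(\mathrm{e}^{-d_i-c_j-b_k-e_k+\mathsf{u}_i-\mathsf{u}_k+\mathsf{w}_i-\mathsf{w}_j+\mathsf{w}_k})^{-1}$$ $$\times P_{ijk}\,\Psi_q(\mathrm{e}^{-b_i-a_j-d_k-e_k+\mathsf{u}_i-\mathsf{u}_k+\mathsf{w}_i-\mathsf{w}_j+\mathsf{w}_k})\,\Psi_q(\mathrm{e}^{-b_i-a_j-d_k+\mathsf{u}_i+\mathsf{u}_k+\mathsf{w}_i-\mathsf{w}_j+\mathsf{w}_k}).$$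 Products are understood formally: using the adjoint action of $N_6\rtimes\mathfrak{S}_6$ (which sends monomials in the $\mathrm{e}^{\mathsf{u}_i},\mathrm{e}^{\mathsf{w}_i}$ to monomials), all factors $P_{ijk}$ are moved to the right, so that each side becomes a product of sixteen factors $\Psi_q(\text{monomial})^{\pm1}$, expanded as a formal Laurent series by $\Psi_q(Y)=\sum_{n\ge0}\frac{(-qY)^n}{(q^2;q^2)_n}$ and $\Psi_q(Y)^{-1}=\sum_{n\ge0}\frac{q^{n^2}Y^n}{(q^2;q^2)_n}$, times an element of $N_6\rtimes\mathfrak{S}_6$. *)

(* Defs.v *)
From HB Require Import structures.
From mathcomp Require Import all_boot all_order all_algebra all_fingroup.
From mathcomp Require Import complex.
From mathcomp Require Import boolp classical_sets functions cardinality fsbigop.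
From mathcomp Require Import reals sequences exp trigo.
From mathcomp Require Import ring.

Set Implicit Arguments.
Unset Strict Implicit.
Unset Printing Implicit Defensive.

Import Order.TTheory GRing.Theory Num.Theory.

Local Open Scope ring_scope.
Local Open Scope complex_scope.

Section ComplexExponential.
Variable R : realType.

Definition cexp (z : R[i]) : R[i] :=
  (expR (complex.Re z) * cos (complex.Im z))
    +i* (expR (complex.Re z) * sin (complex.Im z)).

Lemma cexpD (x y : R[i]) : cexp (x + y) = cexp x * cexp y.
Proof.
case: x y => [a b] [c d]; rewrite /cexp /= expRD cosD sinD.
by apply/eqP; rewrite eq_complex /=; apply/andP; split; apply/eqP; ring.
Qed.

Lemma cexp0 : cexp 0 = 1.
Proof. by rewrite /cexp /= expR0 cos0 sin0 mul1r mulr0. Qed.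

Lemma cexpNK (x : R[i]) : cexp (- x) * cexp x = 1.
Proof. by rewrite -cexpD addNr cexp0. Qed.

Lemma cexp_neq0 (x : R[i]) : cexp x != 0.
Proof.
by apply/eqP => x0; have /eqP := cexpNK x; rewrite x0 mulr0 eq_sym oner_eq0.
Qed.

Lemma cexpN (x : R[i]) : cexp (- x) = (cexp x)^-1.
Proof. by rewrite -[LHS](mulfK (cexp_neq0 x)) cexpNK mul1r. Qed.

End ComplexExponential.

Definition dot (K : pzRingType) (x y : 'cV[K]_6) : K := (x^T *m y) 0 0.

Section Dot.
Variable K : comPzRingType.
Implicit Types x y z : 'cV[K]_6.

Lemma dotC x y : dot x y = dot y x.
Proof. by rewrite /dot -{1}(trmxK y) -trmx_mul mxE. Qed.

Lemma dotDl x y z : dot (x + y) z = dot x z + dot y z.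
Proof. by rewrite /dot linearD mulmxDl mxE. Qed.

Lemma dotDr x y z : dot x (y + z) = dot x y + dot x z.
Proof. by rewrite /dot mulmxDr mxE. Qed.

Lemma dotNl x y : dot (- x) y = - dot x y.
Proof. by rewrite /dot linearN mulNmx mxE. Qed.

Lemma dotNr x y : dot x (- y) = - dot x y.
Proof. by rewrite /dot mulmxN mxE. Qed.

Lemma dotZl (a : K) x y : dot (a *: x) y = a * dot x y.
Proof. by rewrite /dot linearZ -scalemxAl mxE. Qed.

Lemma dotZr (a : K) x y : dot x (a *: y) = a * dot x y.
Proof. by rewrite /dot -scalemxAr mxE. Qed.

Lemma dot0l x : dot 0 x = 0.
Proof. by rewrite /dot trmx0 mul0mx mxE. Qed.

Lemma dot0r x : dot x 0 = 0.
Proof. by rewrite /dot mulmx0 mxE. Qed.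

Lemma dot_mull (A : 'M[K]_6) x y : dot (A *m x) y = dot x (A^T *m y).
Proof. by rewrite /dot trmx_mul mulmxA. Qed.

Lemma dot_perm (s : 'S_6) x y : dot (row_perm s x) (row_perm s y) = dot x y.
Proof.
rewrite /dot !mxE [RHS](reindex_inj (@perm_inj _ s)).
by apply: eq_bigr => i _; rewrite !mxE.
Qed.

End Dot.

(* Contragredient of an integer matrix. *)
Definition dual (M : 'M[int]_6) : 'M[int]_6 := (invmx M)^T.

(* Permuting the indices: the coefficient of u_i (resp. u_i w_j) becomes the
   coefficient of u_(s i) (resp. u_(s i) w_(s j)). *)
Definition perm_vec (K : Type) (s : 'S_6) (x : 'cV[K]_6) : 'cV[K]_6 :=
  row_perm s^-1 x.
Definition perm_mat (K : Type) (s : 'S_6) (M : 'M[K]_6) : 'M[K]_6 :=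
  row_perm s^-1 (col_perm s^-1 M).

Lemma dual1 : dual 1%:M = 1%:M.
Proof. by rewrite /dual invmx1 trmx1. Qed.

Lemma dual_trK (M : 'M[int]_6) : M \in unitmx -> (dual M)^T *m M = 1%:M.
Proof. by move=> uM; rewrite /dual trmxK mulVmx. Qed.

Lemma dual_mulTr (M : 'M[int]_6) : M \in unitmx -> dual M *m M^T = 1%:M.
Proof. by move=> uM; rewrite /dual -trmx_mul mulmxV // trmx1. Qed.

Lemma invmxM6 (A B : 'M[int]_6) :
  A \in unitmx -> B \in unitmx -> invmx (A *m B) = invmx B *m invmx A.
Proof.
move=> uA uB; have uAB : A *m B \in unitmx by rewrite unitmx_mul uA.
have AB1 : A *m B *m (invmx B *m invmx A) = 1%:M.
  by rewrite mulmxA -(mulmxA A) mulmxV // mulmx1 mulmxV.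
by rewrite -[LHS]mulmx1 -AB1 mulmxA mulVmx // mul1mx.
Qed.

Lemma dualM (A B : 'M[int]_6) : A \in unitmx -> B \in unitmx ->
  dual (A *m B) = dual A *m dual B.
Proof. by move=> uA uB; rewrite /dual invmxM6 // trmx_mul. Qed.

Lemma perm_matM (K : comPzRingType) s (A B : 'M[K]_6) :
  perm_mat s (A *m B) = perm_mat s A *m perm_mat s B.
Proof.
apply/matrixP=> i j; rewrite !mxE (reindex_inj (@perm_inj _ s^-1)%g).
by apply: eq_bigr => k _; rewrite !mxE.
Qed.

Lemma perm_mat_vec (K : comPzRingType) s (A : 'M[K]_6) (x : 'cV[K]_6) :
  perm_vec s (A *m x) = perm_mat s A *m perm_vec s x.
Proof.
apply/matrixP=> i j; rewrite !mxE (reindex_inj (@perm_inj _ s^-1)%g).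
by apply: eq_bigr => k _; rewrite !mxE.
Qed.

Lemma perm_mat1 (K : pzRingType) s : perm_mat s 1%:M = 1%:M :> 'M[K]_6.
Proof. by apply/matrixP=> i j; rewrite !mxE (inj_eq perm_inj). Qed.

Lemma det_perm_mat s (M : 'M[int]_6) : \det (perm_mat s M) = \det M.
Proof.
rewrite /perm_mat row_permE col_permE !det_mulmx !det_perm !odd_permV.
by rewrite mulrCA -expr2 sqrr_sign mulr1.
Qed.

Lemma perm_mat_tr (K : Type) s (M : 'M[K]_6) : (perm_mat s M)^T = perm_mat s M^T.
Proof. by apply/matrixP=> i j; rewrite !mxE. Qed.

Lemma perm_dual s (M : 'M[int]_6) :
  M \in unitmx -> dual (perm_mat s M) = perm_mat s (dual M).
Proof.
move=> uM; rewrite /dual -perm_mat_tr; congr trmx.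
have uP : perm_mat s M \in unitmx by rewrite unitmxE det_perm_mat -unitmxE.
rewrite -[LHS]mulmx1 -(perm_mat1 _ s) -(mulmxV uM) perm_matM.
by rewrite mulmxA mulVmx // mul1mx.
Qed.

Section GroupN6.
Variables (R : realType) (hbar : R[i]).
Local Notation C := R[i].

Definition cmx m n (M : 'M[int]_(m, n)) : 'M[C]_(m, n) := map_mx intr M.

Lemma cmxM m n p (A : 'M[int]_(m, n)) (B : 'M[int]_(n, p)) :
  cmx (A *m B) = cmx A *m cmx B.
Proof. exact: map_mxM. Qed.

Lemma cmx1 : cmx 1%:M = 1%:M :> 'M_6.
Proof. exact: map_mx1. Qed.

Lemma cmx_tr m n (A : 'M[int]_(m, n)) : cmx A^T = (cmx A)^T.
Proof. by rewrite /cmx map_trmx. Qed.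

Lemma dot_cmx (x y : 'cV[int]_6) : dot (cmx x) (cmx y) = (dot x y)%:~R.
Proof.
rewrite /dot !mxE rmorph_sum; apply: eq_bigr => i _.
by rewrite !mxE rmorphM.
Qed.

Lemma dot_dual M x y : M \in unitmx ->
  dot (cmx (dual M) *m x) (cmx M *m y) = dot x y.
Proof.
by move=> uM; rewrite dot_mull -cmx_tr mulmxA -cmxM dual_trK // cmx1 mul1mx.
Qed.

(* [groupN6] is realised by its normal forms
     [N6scal * e^(N6w . w / hbar) * e^(N6u . u / hbar) * T_(N6lin)],
   where [T_M], a product of elements [e^(+-u_i w_j / hbar)], commutes past
   linear forms by [T_M (r . w) = (M r . w) T_M] and
   [T_M (p . u) = (M^-T p . u) T_M], so that [e^(u_i w_j / hbar)] is [T_M]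
   with [M = 1 + E_(j i)].  The elementary matrices generate [SL_6(Z)], hence
   the linear parts are the integer matrices of determinant 1. *)
Record N6data := N6Data {
  N6scal : C;
  N6w : 'cV[C]_6;
  N6u : 'cV[C]_6;
  N6lin : 'M[int]_6
}.

Definition N6tuple (x : N6data) := (N6scal x, N6w x, N6u x, N6lin x).
Definition tupleN6 (t : C * 'cV[C]_6 * 'cV[C]_6 * 'M[int]_6) :=
  let: (c, b, a, M) := t in N6Data c b a M.
Lemma N6tupleK : cancel N6tuple tupleN6. Proof. by case. Qed.
HB.instance Definition _ := Choice.copy N6data (can_type N6tupleK).

Definition inN6 (x : N6data) := (N6scal x != 0) && (\det (N6lin x) == 1).

(* The type is indexed by [hbar], on which the multiplication depends. *)
Record groupN6 (h : C) := MkN6 { N6val :> N6data; N6valP : inN6 N6val }.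
HB.instance Definition _ h := [isSub for @N6val h].
HB.instance Definition _ h := [Choice of groupN6 h by <:].
Local Notation N6 := (groupN6 hbar).

Lemma N6scal_neq0 (x : N6) : N6scal x != 0.
Proof. by case/andP: (N6valP x). Qed.

Lemma N6det (x : N6) : \det (N6lin x) = 1.
Proof. by case/andP: (N6valP x) => _ /eqP. Qed.

Lemma N6unit (x : N6) : N6lin x \in unitmx.
Proof. by rewrite unitmxE N6det unitr1. Qed.

Lemma N6P (x y : N6) :
  N6scal x = N6scal y -> N6w x = N6w y -> N6u x = N6u y ->
  N6lin x = N6lin y -> x = y.
Proof.
case: x y => [[c b a M] hx] [[c' b' a' M'] hy] /= Ec Eb Ea EM.
by apply: val_inj; rewrite /= Ec Eb Ea EM.
Qed.

(* Baker-Campbell-Hausdorff: [e^(a.u/hbar) e^(b.w/hbar)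
   = e^(a.b/hbar) e^(b.w/hbar) e^(a.u/hbar)]. *)
Definition N6mul_data (x y : N6data) : N6data :=
  let b := cmx (N6lin x) *m N6w y in
  N6Data (N6scal x * N6scal y * cexp (dot (N6u x) b / hbar))
         (N6w x + b)
         (N6u x + cmx (dual (N6lin x)) *m N6u y)
         (N6lin x *m N6lin y).

Fact N6mul_subproof (x y : N6) : inN6 (N6mul_data x y).
Proof.
rewrite /inN6 /= det_mulmx !N6det mulr1 eqxx andbT.
by rewrite !mulf_neq0 ?cexp_neq0 ?N6scal_neq0.
Qed.
Definition N6mul (x y : N6) : N6 := MkN6 hbar (N6mul_subproof x y).

Fact N6one_subproof : inN6 (N6Data 1 0 0 1%:M).
Proof. by rewrite /inN6 /= oner_eq0 det1 eqxx. Qed.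
Definition N6one : N6   := MkN6 hbar N6one_subproof.

Definition N6inv_data (x : N6data) : N6data :=
  N6Data ((N6scal x)^-1 * cexp (dot (N6u x) (N6w x) / hbar))
         (- (cmx (invmx (N6lin x)) *m N6w x))
         (- (cmx (N6lin x)^T *m N6u x))
         (invmx (N6lin x)).

Fact N6inv_subproof (x : N6) : inN6 (N6inv_data x).
Proof.
rewrite /inN6 /= mulf_neq0 ?invr_eq0 ?N6scal_neq0 ?cexp_neq0 //=.
by rewrite det_inv N6det invr1.
Qed.
Definition N6inv (x : N6) : N6 := MkN6 hbar (N6inv_subproof x).

Fact cocycle (c1 c2 c3 s t r : C) :
  c1 * (c2 * c3 * cexp (r / hbar)) * cexp ((s + t) / hbar)
    = c1 * c2 * cexp (s / hbar) * c3 * cexp ((t + r) / hbar).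
Proof.
rewrite !mulrDl !cexpD.
move: (cexp (s / _)) (cexp (t / _)) (cexp (r / _)) => {}s {}t {}r; ring.
Qed.

Fact N6mulA : associative N6mul.
Proof.
move=> x y z; apply: N6P => /=.
- rewrite cmxM -[cmx _ *m cmx _ *m _]mulmxA mulmxDr dotDl dotDr.
  by rewrite (dot_dual _ _ (N6unit x)) cocycle.
- by rewrite cmxM mulmxDr mulmxA addrA.
- by rewrite dualM ?N6unit // cmxM mulmxDr mulmxA addrA.
- by rewrite mulmxA.
Qed.

Fact N6mul1g : left_id N6one N6mul.
Proof.
move=> x; apply: N6P => /=.
- by rewrite dot0l mul0r cexp0 mulr1 mul1r.
- by rewrite cmx1 mul1mx add0r.
- by rewrite dual1 cmx1 mul1mx add0r.
- by rewrite mul1mx.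
Qed.

Fact N6mulg1 : right_id N6one N6mul.
Proof.
move=> x; apply: N6P => /=.
- by rewrite mulmx0 dot0r mul0r cexp0 !mulr1.
- by rewrite mulmx0 addr0.
- by rewrite mulmx0 addr0.
- by rewrite mulmx1.
Qed.

Fact N6mulVg : left_inverse N6one N6inv N6mul.
Proof.
move=> x; have ux := N6unit x; apply: N6P => /=.
- rewrite dotNl dot_mull -cmx_tr trmxK mulmxA -cmxM mulmxV // cmx1 mul1mx.
  rewrite mulNr cexpN mulrAC mulfK ?cexp_neq0 //.
  by rewrite mulVf ?N6scal_neq0.
- by rewrite addNr.
- by rewrite /dual invmxK addNr.
- by rewrite mulVmx.
Qed.

Fact N6mulgV : right_inverse N6one N6inv N6mul.
Proof.
move=> x; have ux := N6unit x; apply: N6P => /=.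
- rewrite mulmxN mulmxA -cmxM mulmxV // cmx1 mul1mx dotNr mulNr cexpN.
  rewrite mulrA mulfK ?cexp_neq0 //.
  by rewrite mulfV ?N6scal_neq0.
- by rewrite mulmxN mulmxA -cmxM mulmxV // cmx1 mul1mx subrr.
- by rewrite mulmxN mulmxA -cmxM dual_mulTr // cmx1 mul1mx subrr.
- by rewrite mulmxV.
Qed.

HB.instance Definition _ :=
  isGroup.Build N6 N6mulA N6mul1g N6mulg1 N6mulVg N6mulgV.

Fact exp_subproof b a : inN6 (N6Data 1 b a 1%:M).
Proof. by rewrite /inN6 /= oner_eq0 det1 eqxx. Qed.

(* [exp_u a] is [e^(a . u / hbar)] and [exp_w b] is [e^(b . w / hbar)]. *)
Definition exp_u (a : 'cV[C]_6) : N6 := MkN6 hbar (exp_subproof 0 a).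
Definition exp_w (b : 'cV[C]_6) : N6 := MkN6 hbar (exp_subproof b 0).

(* [exp_uw m i j] is [e^(m u_i w_j / hbar)], meaningful for [i != j] only. *)
Definition exp_uw (m : int) (i j : 'I_6) : N6 :=
  insubd N6one (N6Data 1 0 0 (1%:M + m *: delta_mx j i)).

Lemma det_elementary (m : int) (i j : 'I_6) : i != j ->
  \det (1%:M + m *: delta_mx j i : 'M[int]_6) = 1.
Proof.
have low (k l : 'I_6) : (k < l)%N ->
    \det (1%:M + m *: delta_mx l k : 'M[int]_6) = 1.
  move=> kl; rewrite det_trig.
    apply: big1 => x _; rewrite !mxE eqxx.
    by case: eqVneq => [->|_]; rewrite ?mulr0 ?addr0 // -val_eqE /= (gtn_eqF kl) mulr0 addr0.
  apply/is_trig_mxP => x y xy; rewrite !mxE.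
  have -> : (x == y) = false by apply/eqP => xyE; rewrite xyE ltnn in xy.
  case: eqVneq => [xl|_]; last by rewrite mulr0 addr0.
  case: eqVneq => [yk|_]; last by rewrite mulr0 addr0.
  by move: xy kl; rewrite xl yk => /ltnW; rewrite leqNgt => /negbTE ->.
move=> ij; have := ij; rewrite neq_ltn => /orP[/low //|ji].
by rewrite -det_tr linearD linearZ /= trmx1 trmx_delta low.
Qed.

Lemma exp_uwE m i j : i != j ->
  N6val (exp_uw m i j) = N6Data 1 0 0 (1%:M + m *: delta_mx j i).
Proof.
by move=> ij; rewrite val_insubd /inN6 /= oner_eq0 det_elementary // eqxx.
Qed.

End GroupN6.

Section Semidirect.
Variables (R : realType) (hbar : R[i]).
Local Notation C := R[i].
Local Notation N6 := (groupN6 hbar).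

Definition N6act_data (s : 'S_6) (x : N6data R) : N6data R :=
  N6Data (N6scal x) (perm_vec s (N6w x)) (perm_vec s (N6u x))
         (perm_mat s (N6lin x)).

Fact N6act_subproof s (x : N6) : inN6 (N6act_data s x).
Proof. by rewrite /inN6 /= det_perm_mat N6det eqxx N6scal_neq0. Qed.
Definition N6act s (x : N6) : N6 := MkN6 hbar (N6act_subproof s x).

Lemma perm_cmx s m (A : 'M[int]_(6, m)) :
  row_perm s (cmx R A) = cmx R (row_perm s A).
Proof. by apply/matrixP => i j; rewrite !mxE. Qed.

Lemma perm_mat_cmx s (A : 'M[int]_6) : perm_mat s (cmx R A) = cmx R (perm_mat s A).
Proof. by apply/matrixP => i j; rewrite !mxE. Qed.

Lemma perm_vecM (K : Type) s t (x : 'cV[K]_6) :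
  perm_vec s (perm_vec t x) = perm_vec (t * s)%g x.
Proof. by apply/matrixP => i j; rewrite !mxE invMg permM. Qed.

Lemma perm_matMg (K : Type) s t (x : 'M[K]_6) :
  perm_mat s (perm_mat t x) = perm_mat (t * s)%g x.
Proof. by apply/matrixP => i j; rewrite !mxE invMg !permM. Qed.

Lemma N6act1 x : N6act 1 x = x.
Proof.
by apply: N6P => //=; apply/matrixP => i j; rewrite !mxE invg1 ?perm1.
Qed.

Lemma N6actA s t x : N6act s (N6act t x) = N6act (t * s)%g x.
Proof. by apply: N6P => //=; rewrite ?perm_vecM ?perm_matMg. Qed.

Lemma N6actM s x y : N6act s (x * y)%g = (N6act s x * N6act s y)%g.
Proof.
apply: N6P => /=.
- by rewrite -perm_mat_cmx -perm_mat_vec dot_perm.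
- by rewrite -perm_mat_cmx -perm_mat_vec /perm_vec linearD.
- rewrite perm_dual ?N6unit // -perm_mat_cmx -perm_mat_vec.
  by rewrite /perm_vec linearD.
- by rewrite perm_matM.
Qed.

Lemma N6act_1 s : N6act s 1%g = 1%g.
Proof. by apply: (mulIg (N6act s 1%g)); rewrite -N6actM !mul1g. Qed.

(* [N_6 x| S_6]: [Semi n s] is [n * s]. The product [s' * s] of perm.v maps
   [x] to [s (s' x)]. *)
Record semi := Semi { semiN : N6; semiS : 'S_6 }.

Definition semi_pair (g : semi) := (semiN g, semiS g).
Definition pair_semi (p : N6 * 'S_6) := Semi p.1 p.2.
Lemma semi_pairK : cancel semi_pair pair_semi. Proof. by case. Qed.
HB.instance Definition _ := Choice.copy semi (can_type semi_pairK).

Definition semi_mul (g h : semi) : semi :=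
  Semi (semiN g * N6act (semiS g) (semiN h))%g (semiS h * semiS g)%g.
Definition semi_one : semi := Semi 1%g 1%g.
Definition semi_inv (g : semi) : semi :=
  Semi (N6act (semiS g)^-1 (semiN g)^-1)%g (semiS g)^-1%g.

Fact semi_mulA : associative semi_mul.
Proof.
by move=> [n s] [m t] [l r]; rewrite /semi_mul /= N6actM N6actA !mulgA.
Qed.

Fact semi_mul1g : left_id semi_one semi_mul.
Proof. by case=> n s; rewrite /semi_mul /= N6act1 mul1g mulg1. Qed.

Fact semi_mulg1 : right_id semi_one semi_mul.
Proof. by case=> n s; rewrite /semi_mul /= N6act_1 mul1g mulg1. Qed.

Fact semi_mulVg : left_inverse semi_one semi_inv semi_mul.
Proof.
by case=> n s; rewrite /semi_mul /= -N6actM mulVg mulgV N6act_1.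
Qed.

Fact semi_mulgV : right_inverse semi_one semi_inv semi_mul.
Proof.
by case=> n s; rewrite /semi_mul /= N6actA mulVg N6act1 mulgV.
Qed.

HB.instance Definition _ :=
  isGroup.Build semi semi_mulA semi_mul1g semi_mulg1 semi_mulVg semi_mulgV.

End Semidirect.

Section Operators.
Variables (R : realType) (hbar : R[i]).
Local Notation C := R[i].
Local Notation N6 := (groupN6 hbar).
Local Notation semi := (semi hbar).

(* The Weyl-ordered monomial [mcoef * e^(mexu . u + mexw . w)]. *)
Record monomial := Monomial {
  mcoef : C;
  mexu : 'cV[int]_6;
  mexw : 'cV[int]_6
}.

Definition mono_one : monomial := Monomial 1 0 0.

Definition mono_scale (a : C) (X : monomial) : monomial :=
  Monomial (a * mcoef X) (mexu X) (mexw X).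

(* Baker-Campbell-Hausdorff: [e^A e^B = e^([A, B] / 2) e^(A + B)]. *)
Definition mono_mul (X Y : monomial) : monomial :=
  Monomial
    (mcoef X * mcoef Y *
     cexp (hbar / 2%:R * (dot (mexu X) (mexw Y) - dot (mexw X) (mexu Y))%:~R))
    (mexu X + mexu Y) (mexw X + mexw Y).

Definition mono_exp (X : monomial) (n : nat) : monomial :=
  Monomial (mcoef X ^+ n) (mexu X *+ n) (mexw X *+ n).

Definition Ad (g : semi) (X : monomial) : monomial :=
  let n := semiN g in
  let p := dual (N6lin n) *m perm_vec (semiS g) (mexu X) in
  let r := N6lin n *m perm_vec (semiS g) (mexw X) in
  Monomial
    (mcoef X * cexp (dot (N6u n) (cmx R r) - dot (N6w n) (cmx R p))) p r.

(* Since [e^(p . u) = e^((hbar p) . u / hbar)], monomials with a nonzero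
   coefficient are elements of [N6]. *)
Definition mono_N6data (X : monomial) : N6data R :=
  N6Data (mcoef X * cexp (hbar / 2%:R * (dot (mexu X) (mexw X))%:~R))
         (hbar *: cmx R (mexw X)) (hbar *: cmx R (mexu X)) 1%:M.

Lemma mono_mulE (x y : N6) X Y : hbar != 0 ->
  N6val x = mono_N6data X -> N6val y = mono_N6data Y ->
  N6val (x * y)%g = mono_N6data (mono_mul X Y).
Proof.
move=> h0 Ex Ey; rewrite /= /N6mul_data Ex Ey /mono_N6data /=.
rewrite dual1 !cmx1 !mul1mx; congr N6Data; last 2 first.
- by rewrite /cmx map_mxD scalerDr.
- by rewrite /cmx map_mxD scalerDr.
rewrite dotZl dotZr dot_cmx !dotDl !dotDr (dotC (mexw X)).
have aux (m1 m2 s t r : C) :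
    m1 * cexp s * (m2 * cexp t) * cexp r = m1 * m2 * cexp (s + t + r).
  by rewrite !cexpD; move: (cexp s) (cexp t) (cexp r) => {}s {}t {}r; ring.
rewrite aux -[RHS]mulrA -cexpD; congr (_ * cexp _).
by rewrite !rmorphD rmorphN /=; field.
Qed.

Lemma Ad_conj (g : semi) (x y : N6) X : hbar != 0 ->
  N6val x = mono_N6data X -> N6val y = mono_N6data (Ad g X) ->
  (g * Semi x 1 * g^-1)%g = Semi y 1.
Proof.
move=> h0 Ex Ey; apply: (mulIg g); rewrite mulgKV.
case: g Ey => [n s] Ey; congr Semi => /=; last by rewrite mulg1 mul1g.
have cmxZ (A : 'M[int]_6) (v : 'cV[int]_6) :
    cmx R A *m perm_vec s (hbar *: cmx R v) = hbar *: cmx R (A *m perm_vec s v).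
  by rewrite /perm_vec linearZ /= perm_cmx -scalemxAr -cmxM.
have un := N6unit n.
rewrite N6act1; apply: N6P; rewrite /= Ex Ey /= ?dual1 ?cmx1 ?mul1mx.
- set p := dual _ *m _; set r := N6lin n *m _.
  have -> : dot (mexu X) (mexw X) = dot p r.
    by rewrite dot_mull /dual trmxK mulKmx // dot_perm.
  rewrite cmxZ -/r dotZr dotZl (dotC (N6w n)).
  have hK (a : C) : hbar * a / hbar = a by rewrite mulrAC mulfV // mul1r.
  rewrite !hK.
  move: (dot _ (cmx R r)) (dot (cmx R p) _) => a b.
  rewrite cexpD cexpN.
  have := cexp_neq0 b; move: (cexp a) (cexp b) (cexp _) => {}a {}b c b0.
  by field.
- by rewrite cmxZ addrC.
- by rewrite cmxZ addrC.
- by rewrite perm_mat1 mulmx1.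
Qed.

(* Operators are formal words: [Dilog true Y] stands for [Psi_q(Y)],
   [Dilog false Y] for its inverse. *)
Inductive factor := Dilog of bool & monomial | Grp of semi.

(* Moves the group elements to the right; [normal_form g ws] normalises
   [g ws]. *)
Fixpoint normal_form (g : semi) (ws : seq factor)
    : seq (bool * monomial) * semi :=
  match ws with
  | [::] => ([::], g)
  | Dilog eps Y :: ws' =>
      let nf := normal_form g ws' in ((eps, Ad g Y) :: nf.1, nf.2)
  | Grp h :: ws' => normal_form (g * h)%g ws'
  end.

Definition dilog_part ws := (normal_form 1%g ws).1.
Definition group_part ws := (normal_form 1%g ws).2.

Definition qpoch (q : C) (n : nat) : C :=
  \prod_(0 <= k < n) (1 - q ^+ 2 * (q ^+ 2) ^+ k).

(* Coefficient of [Y^n] in [Psi_q(Y)], resp. [Psi_q(Y)^-1]. *)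
Definition Psi_coef (q : C) (eps : bool) (n : nat) : C :=
  if eps then (- q) ^+ n / qpoch q n else q ^+ (n ^ 2) / qpoch q n.

Definition Psi_term (f : bool * monomial) (n : nat) : monomial :=
  mono_scale (Psi_coef (cexp hbar) f.1 n) (mono_exp f.2 n).

(* The term of multi-index [ns] in the expansion of a product of
   quantum dilogarithms. *)
Definition prod_term (l : seq (bool * monomial)) (ns : seq nat) : monomial :=
  foldr (fun fn X => mono_mul (Psi_term fn.1 fn.2) X) mono_one (zip l ns).

Definition terms_at (l : seq (bool * monomial)) (p r : 'cV[int]_6)
    : set ((size l).-tuple nat) :=
  [set ns | mexu (prod_term l ns) = p /\ mexw (prod_term l ns) = r]%classic.
Arguments terms_at l p r : clear implicits.

Definition expandable (l : seq (bool * monomial)) : Prop :=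
  forall p r, finite_set (terms_at l p r).

(* Coefficient of [e^(p . u + r . w)]; only meaningful if [expandable l]. *)
Definition expansion (l : seq (bool * monomial)) (p r : 'cV[int]_6) : C :=
  \sum_(ns \in terms_at l p r) mcoef (prod_term l ns).

(* Both sides are well-defined formal Laurent series times an element of the
   group, and these agree. *)
Definition formal_eq (ws ws' : seq factor) : Prop :=
  [/\ expandable (dilog_part ws), expandable (dilog_part ws'),
      forall p r, expansion (dilog_part ws) p r = expansion (dilog_part ws') p r
    & group_part ws = group_part ws'].

Record param := Param { pa : C; pb : C; pc : C; pd : C; pe : C }.

Section ROperator.
Variables (Pi Pj Pk : param) (i j k : 'I_6).

Let bas (K : pzRingType) (l : 'I_6) : 'cV[K]_6 := delta_mx l 0.

Definition lam0 : C := (pe Pj - pe Pk) / 2%:R.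
Definition lam1 : C := pa Pj - pa Pk + pb Pj - pb Pk + lam0.
Definition lam2 : C := - pa Pi - pb Pj + pb Pk - lam0.
Definition lam3 : C := pc Pi - pc Pj + pc Pk.

(* [e^((u_k - u_j) w_i / hbar)] is the product of the commuting elements
   [e^(u_k w_i / hbar)] and [e^(- u_j w_i / hbar)]. *)
Definition Pop : semi :=
  Semi (exp_uw hbar 1 k i * exp_uw hbar (-1) j i
        * exp_w hbar (lam0 *: (- bas C i - bas C j + bas C k))
        * exp_u hbar (lam1 *: bas C i + lam2 *: bas C j + lam3 *: bas C k))%g
       (tperm j k).

(* [e^(c + u_i + m u_k + w_i - w_j + w_k)]. *)
Let mono (c : C) (m : int) : monomial :=
  Monomial (cexp c) (bas int i + m *: bas int k)
           (bas int i - bas int j + bas int k).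

Definition Rop : seq factor :=
  [:: Dilog false (mono (- pd Pi - pc Pj - pb Pk) 1);
      Dilog false (mono (- pd Pi - pc Pj - pb Pk - pe Pk) (-1));
      Grp Pop;
      Dilog true (mono (- pb Pi - pa Pj - pd Pk - pe Pk) (-1));
      Dilog true (mono (- pb Pi - pa Pj - pd Pk) 1)].

End ROperator.
End Operators.

Definition i1 : 'I_6 := @Ordinal 6 0 isT.
Definition i2 : 'I_6 := @Ordinal 6 1 isT.
Definition i3 : 'I_6 := @Ordinal 6 2 isT.
Definition i4 : 'I_6 := @Ordinal 6 3 isT.
Definition i5 : 'I_6 := @Ordinal 6 4 isT.
Definition i6 : 'I_6 := @Ordinal 6 5 isT.

(* Main.v *)
(* Moving the group elements to the right turns each side into a product of
   sixteen factors [Psi_q(Y)^+-1].  The exponents of all monomials [Y] lie in an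
   open half-space of [Z^12], so that the products are expandable, and their
   coefficients are the values of one character of [Z^12].  The products act by
   twisted translations on the functions on [Z^12] supported in the closed
   half-space.  There [Psi_q(U)] and [Psi_q(V)] commute if [U] and [V] do, and
   [Psi_q(U) Psi_q(V) = Psi_q(V) Psi_q(W) Psi_q(U)] if [U V = q^2 V U], with [W]
   the Weyl-ordered product of [U] and [V].  The left-hand word times the inverse
   of the right-hand word reduces to the empty word by sixteen of these pentagon
   relations.  A series is recovered from its action on the delta function at
   the origin. *)

Require Import Defs.
From mathcomp Require Import all_boot all_order all_algebra all_fingroup.
From mathcomp Require Import complex reals.
From mathcomp Require Import boolp classical_sets cardinality fsbigop.
From mathcomp Require Import ring.

Set Implicit Arguments.
Unset Strict Implicit.
Unset Printing Implicit Defensive.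

Import Order.TTheory GRing.Theory Num.Theory.

Local Open Scope ring_scope.
Local Open Scope complex_scope.

(** * q-series identities *)

Section QSeries.
Variables (R : realType) (q : R[i]).
Hypothesis q_neq0 : q != 0.
Hypothesis q_generic : forall n : nat, (0 < n)%N -> q ^+ n != 1.
Local Notation Q := (q ^+ 2).

Lemma qpoch0 : qpoch q 0 = 1.
Proof. by rewrite /qpoch big_mkord big_ord0. Qed.

Lemma qpochS n : qpoch q n.+1 = qpoch q n * (1 - Q ^+ n.+1).
Proof. by rewrite /qpoch big_nat_recr // (exprS Q). Qed.

Lemma qpoch_neq0 n : qpoch q n != 0.
Proof.
elim: n => [|n IHn]; first by rewrite qpoch0 oner_eq0.
by rewrite qpochS mulf_neq0 // subr_eq0 eq_sym -exprM q_generic.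
Qed.

(** Gaussian binomial coefficient in base [q ^+ 2], given by a Pascal recursion: no division occurs,
    and it vanishes for [k > n]. *)
Fixpoint qbin (n k : nat) : R[i] :=
  match n, k with
  | _, 0 => 1
  | 0, _.+1 => 0
  | n'.+1, k'.+1 => Q ^+ k * qbin n' k + qbin n' k'
  end.

Lemma qbin0 n : qbin n 0 = 1. Proof. by case: n. Qed.

Lemma qbinS n k : qbin n.+1 k.+1 = Q ^+ k.+1 * qbin n k.+1 + qbin n k.
Proof. by []. Qed.

Lemma qbin_small n k : (n < k)%N -> qbin n k = 0.
Proof.
elim: n k => [|n IHn] [|k] //; rewrite ltnS => nk.
by rewrite qbinS !IHn ?mulr0 ?addr0 // ltnW.
Qed.

Lemma qbin_qpoch n k : (k <= n)%N ->
  qbin n k * (qpoch q k * qpoch q (n - k)) = qpoch q n.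
Proof.
elim: n k => [|n IHn] [|k] // kn; rewrite ?qbin0 ?qpoch0 ?subn0 ?mul1r //.
rewrite qbinS subSS; rewrite ltnS in kn.
have E1 := IHn k kn; rewrite qpochS (qpochS n).
case: (ltngtP k n) kn => // [kn _|kn _].
  have := IHn k.+1 kn; rewrite qpochS => E2.
  have dE : (n - k = (n - k.+1).+1)%N by rewrite subnSK.
  move: E1; rewrite dE qpochS => E1.
  have -> : Q ^+ n.+1 = Q ^+ k.+1 * Q ^+ (n - k.+1).+1.
    by rewrite -exprD -dE addSn subnKC // ltnW.
  rewrite mulrDl -mulrA.
  set A := qpoch q (n - k.+1) in E1 E2 *; set B := qpoch q k in E1 E2 *.
  set x := Q ^+ k.+1 in E1 E2 *; set y := Q ^+ _ in E1 E2 *.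
  (* The two terms of the recursion contribute the factors [x * (1 - y)] and [1 - x], which add up
     to [1 - x * y = 1 - Q ^+ n.+1]. *)
  transitivity (x * (1 - y) * qpoch q n + (1 - x) * qpoch q n); last by ring.
  by rewrite -{1}E2 -E1; ring.
rewrite kn in E1 *; rewrite qbin_small // mulr0 add0r.
by rewrite (mulrAC (qpoch q n)) mulrA E1.
Qed.

(* Newton interpolation of [x ^ n] on the nodes [1, q^2, q^4, ...]; the nodes
   give the pentagon identity and [x = 0] the inverse of [Psi_q]. *)
Lemma qnewton n N (x : R[i]) : (n < N)%N ->
  \sum_(k < N) (-1) ^+ k * q ^+ (k * k.-1) * qbin n k
     * \prod_(m < k) (1 - x / Q ^+ m) = x ^+ n.
Proof.
elim: n N => [|n IHn] [|N] //; rewrite ltnS => nN.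
  rewrite big_ord_recl [X in _ + X]big1 => [|k _]; last first.
    by rewrite qbin_small // mulr0 mul0r.
  by rewrite qbin0 big_ord0 !mulr1 addr0.
set P := fun k => \prod_(m < k) (1 - x / Q ^+ m).
pose A k := (-1) ^+ k * q ^+ (k * k.-1) * qbin n k * P k.
(* With [B k] for [Q ^+ k * A k], the term of index [k.+1] is [B k.+1 - B k + x * A k], and the term
   of index 0 is [B 0]. The differences telescope, [B N] vanishes since [n < N], and [x] times the
   sum for [n] remains. *)
have step k : (-1) ^+ k.+1 * q ^+ (k.+1 * k) * qbin n.+1 k.+1 * P k.+1
    = Q ^+ k.+1 * A k.+1 + (- (Q ^+ k * A k) + x * A k).
  rewrite qbinS /A /= {1 3}/P big_ord_recr /= -/(P k).
  rewrite [in P k.+1]/P big_ord_recr /=.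
  rewrite -/(P k).
  have -> : (k.+1 * k = k * k.-1 + 2 * k)%N.
    by case: k => // k /=; rewrite (mulnC k.+1 k) -mulnDl addn2.
  rewrite exprD (exprM q 2) (exprS (-1)).
  have QK : Q ^+ k != 0 by rewrite !expf_neq0.
  by field.
pose T k := (-1) ^+ k * q ^+ (k * k.-1) * qbin n.+1 k * P k.
rewrite -[LHS]/(\sum_(k < N.+1) T k) big_ord_recl.
have -> : T (@ord0 N) = Q ^+ (@ord0 N) * A (@ord0 N).
  by rewrite /T /A /= qbin0 !expr0 !mul1r.
rewrite (eq_bigr (fun k : 'I_N => Q ^+ (lift ord0 k) * A (lift ord0 k)
  + (- (Q ^+ k * A k) + x * A k))) => [|k _]; last exact: step.
rewrite !big_split /= sumrN -mulr_sumr (IHn N nN) (addrA (_ * A 0%N)).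
have <- : \sum_(k < N.+1) Q ^+ k * A k = Q ^+ 0 * A 0%N
    + \sum_(k < N) Q ^+ (bump 0 k) * A (bump 0 k).
  by rewrite big_ord_recl.
rewrite big_ord_recr /=.
rewrite [A N]/A qbin_small // mulr0 mul0r mulr0 addr0.
by rewrite addrA subrr add0r exprS.
Qed.

(** This is [qnewton] at [x = 0], where every node product is 1 and [x ^+ n] becomes a Kronecker
    symbol, scaled by [(- q) ^+ n / qpoch q n]. *)
Lemma Psi_coef_inv n :
  \sum_(k < n.+1) Psi_coef q true (n - k) * Psi_coef q false k = (n == 0)%:R.
Proof.
have := @qnewton n n.+1 0 (leqnn _); rewrite expr0n.
move=> /(congr1 (fun x => (- q) ^+ n / qpoch q n * x)).
have -> : (- q) ^+ n / qpoch q n * (n == 0)%:R = (n == 0)%:R.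
  by case: n => [|n]; rewrite ?mulr0 // qpoch0 divr1 mulr1.
move=> <-; rewrite mulr_sumr; apply: eq_bigr => k _.
rewrite big1 ?mulr1 => [|m _]; last by rewrite mul0r subr0.
have kn : (k <= n)%N by rewrite -ltnS.
rewrite /Psi_coef -(qbin_qpoch kn).
have := qpoch_neq0 n; rewrite -(qbin_qpoch kn) mulf_eq0 negb_or => /andP[b0 _].
have -> : (k ^ 2 = k * k.-1 + k)%N by case: (val k) => // m /=; rewrite -mulnSr.
have -> : (- q) ^+ n = (- q) ^+ (n - k) * ((-1) ^+ k * q ^+ k).
  by rewrite -exprMn mulN1r -exprD subnK.
rewrite exprD; have := qpoch_neq0 k; have := qpoch_neq0 (n - k).
have s1 : ((-1) ^+ k * (-1) ^+ k = 1 :> R[i]) by rewrite -expr2 sqrr_sign.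
set s := (-1) ^+ k in s1 *.
(* The right-hand side contains the sign [s] twice, the left-hand side not at all; the factor
   [s * s = 1] reconciles them. *)
move=> ? ?; rewrite -[LHS]mulr1 -s1; field.
by rewrite b0; apply/and3P.
Qed.

(** At the node [Q ^+ j] the Newton basis polynomial is a falling q-factorial, since
    [Q ^+ j / Q ^+ m = Q ^+ (j - m)]. *)
Lemma qfalling j k : (k <= j)%N ->
  \prod_(m < k) (1 - Q ^+ j / Q ^+ m) * qpoch q (j - k) = qpoch q j.
Proof.
elim: k => [|k IHk] kj; first by rewrite big_ord0 mul1r subn0.
rewrite big_ord_recr /= -[RHS]IHk ?(ltnW kj) // -(subnSK kj) qpochS.
have -> : Q ^+ j / Q ^+ k = Q ^+ (j - k.+1).+1.
  by rewrite subnSK // expfB // -exprM expf_neq0.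
by ring.
Qed.

Lemma qfalling_small j k : (j < k)%N ->
  \prod_(m < k) (1 - Q ^+ j / Q ^+ m) = 0.
Proof.
move=> jk; apply/eqP/prodf_eq0; exists (Ordinal jk) => //=.
by rewrite divff ?subrr // !expf_neq0.
Qed.

(** Up to a common power of [q], these are the coefficients of exponent [i u + j v] on the two sides
    of the pentagon, [k] being the multiplicity of [u + v]. The identity is [qnewton] at the node
    [Q ^+ j]: the binomial kills [k > i] and the node product kills [k > j]. *)
Lemma Psi_coef_pentagon i j N : (i < N)%N ->
  \sum_(k < N | (k <= i)%N && (k <= j)%N)
     Psi_coef q true (i - k) * Psi_coef q true (j - k) * Psi_coef q true k
       * q ^+ (k * k)
  = Psi_coef q true i * Psi_coef q true j * Q ^+ (i * j).
Proof.
move=> iN; rewrite mulnC exprM -(qnewton (Q ^+ j) iN) mulr_sumr.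
rewrite [RHS](bigID (fun k : 'I_N => (k <= i)%N && (k <= j)%N)) /=.
rewrite [X in _ + X]big1 ?addr0 => [|k]; last first.
  rewrite negb_and -!ltnNge => /orP[ik|jk].
    by rewrite qbin_small // mulr0 mul0r mulr0.
  by rewrite qfalling_small // !mulr0.
apply: eq_bigr => k /andP[ki kj].
rewrite /Psi_coef -(qbin_qpoch ki).
have := qpoch_neq0 i; rewrite -(qbin_qpoch ki) mulf_eq0 negb_or => /andP[b0 _].
have := qpoch_neq0 j; rewrite -(qfalling kj) mulf_eq0 negb_or => /andP[f0 _].
have -> : (k * k = k * k.-1 + k)%N by case: (val k) => // m /=; rewrite -mulnSr.
have E n : (k <= n)%N -> (- q) ^+ n = (- q) ^+ (n - k) * ((-1) ^+ k * q ^+ k).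
  by move=> kn; rewrite -exprMn mulN1r -exprD subnK.
rewrite (E i ki) (E j kj) exprD.
set p := \prod_(m < k) _ in f0 *.
have -> : (- q) ^+ k = (-1) ^+ k * q ^+ k by rewrite -exprMn mulN1r.
have := qpoch_neq0 k; have := qpoch_neq0 (i - k); have := qpoch_neq0 (j - k).
have s1 : ((-1) ^+ k * (-1) ^+ k = 1 :> R[i]) by rewrite -expr2 sqrr_sign.
set s := (-1) ^+ k in s1 *.
move=> ? ? ?; rewrite -[LHS]mulr1 -s1.
field.
by rewrite b0 f0 andbT; apply/and4P.
Qed.

End QSeries.

(** * Reindexing of truncated sums *)

Section ShiftedSums.
Variable V : nmodType.

Lemma sum_ord_widen (g : nat -> V) N M :
  (M <= N)%N -> (forall i, (M <= i)%N -> g i = 0) ->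
  \sum_(i < N) g i = \sum_(i < M) g i.
Proof.
move=> MN g0; rewrite (big_ord_widen _ _ MN) [RHS]big_mkcond /=.
by apply: eq_bigr => i _; case: ltnP => // /g0.
Qed.

Lemma sum_ord_shift (g : nat -> V) N k :
  (forall i, (N <= i)%N -> g i = 0) ->
  \sum_(i < N) g (i + k)%N = \sum_(i < N | (k <= i)%N) g i.
Proof.
move=> g0; rewrite [RHS]big_mkcond /=.
pose g' i := if (k <= i)%N then g i else 0.
rewrite -(@sum_ord_widen g' (k + N) N) ?leq_addl //; last first.
  by move=> i /g0 gi; rewrite /g' gi if_same.
rewrite big_split_ord /= [X in _ = X + _]big1 ?add0r; last first.
  by move=> i _; rewrite /g' leqNgt ltn_ord.
by apply: eq_bigr => i _; rewrite /g' leq_addr addnC.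
Qed.

End ShiftedSums.

(** * The pentagon identity *)

Section PentagonVariants.
Variables (T : Type) (S : T -> Prop) (U V W : bool -> T -> T).
Hypotheses (SU : forall e x, S x -> S (U e x))
  (SV : forall e x, S x -> S (V e x))
  (SW : forall e x, S x -> S (W e x)).
Hypotheses (UK : forall e x, S x -> U e (U (~~ e) x) = x)
  (VK : forall e x, S x -> V e (V (~~ e) x) = x)
  (WK : forall e x, S x -> W e (W (~~ e) x) = x).
Hypothesis UV : forall x, S x -> U true (V true x) = V true (W true (U true x)).

Let UKt x (Sx : S x) := UK true Sx.
Let UKf x (Sx : S x) := UK false Sx.
Let VKt x (Sx : S x) := VK true Sx.
Let VKf x (Sx : S x) := VK false Sx.
Let WKt x (Sx : S x) := WK true Sx.
Let WKf x (Sx : S x) := WK false Sx.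

(** The sign variants arise by multiplying the pentagon, or an earlier variant, by inverse letters;
    [front] and [back] tell where [W] ends up. Inverses are available on the invariant set [S]
    only. *)
Lemma pentagon_pn_front x : S x ->
  V false (U true x) = W true (U true (V false x)).
Proof.
move=> Sx; have Sy : S (V false x) by exact: SV.
by rewrite -{1}(VKt Sx) UV // VKf //; apply/SW/SU.
Qed.

Lemma pentagon_np_back x : S x ->
  U false (V true x) = V true (U false (W false x)).
Proof.
move=> Sx; have Sy : S (U false (W false x)) by apply/SU/SW.
have := UV Sy; rewrite UKt ?WKt //; last exact: SW.
by move=> <-; rewrite UKf //; apply: SV.
Qed.

Lemma pentagon_pn_back x : S x ->
  V true (U false x) = U false (V true (W true x)).
Proof.
move=> Sx; have Sy : S (U false (W true x)) by apply/SU/SW.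
rewrite pentagon_np_back; last exact: SW.
by rewrite WKf.
Qed.

Lemma pentagon_np_front x : S x ->
  U true (V false x) = W false (V false (U true x)).
Proof.
move=> Sx; rewrite pentagon_pn_front // WKf //.
by apply/SU/SV.
Qed.

Lemma pentagon_nn x : S x ->
  V false (U false x) = U false (W false (V false x)).
Proof.
move=> Sx; have Sy : S (U false (W false (V false x))) by apply/SU/SW/SV.
rewrite -[RHS]VKf //; congr (V false _).
rewrite pentagon_pn_back; last by apply/SW/SV.
by rewrite WKt ?VKt //; apply: SV.
Qed.

End PentagonVariants.

Local Arguments Psi_coef : simpl never.

(** * Dilogarithms as operators on functions supported in nonnegative degrees *)

Section Dilogarithms.
Variables (R : realType) (hbar : R[i]).
Local Notation C := R[i].
Local Notation q := (cexp hbar).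
Hypothesis q_generic : forall n : nat, (0 < n)%N -> q ^+ n != 1.

(** The power of [q] with exponent [m / 2], its branch fixed by [hbar]; Weyl ordering produces
    half-integral powers. *)
Definition chi (m : int) : C := cexp (hbar / 2%:R * m%:~R).

Lemma chiD m n : chi (m + n) = chi m * chi n.
Proof. by rewrite /chi rmorphD mulrDr cexpD. Qed.

Lemma chi0 : chi 0 = 1.
Proof. by rewrite /chi mulr0 cexp0. Qed.

Lemma cexpMn (x : C) n : cexp (x *+ n) = cexp x ^+ n.
Proof.
by elim: n => [|n IHn]; rewrite ?cexp0 // mulrS cexpD IHn exprS.
Qed.

Lemma chi2 n : chi (2 * n%:Z) = q ^+ n.
Proof.
rewrite /chi -cexpMn; congr cexp.
by rewrite rmorphM /= mulrA divfK ?pnatr_eq0 // mulr_natr.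
Qed.

Variables (A : zmodType) (omega : A -> A -> int) (deg : A -> int).
Variable psi : A -> C.
Hypothesis omegaDl : forall x y z, omega (x + y) z = omega x z + omega y z.
Hypothesis omegaDr : forall x y z, omega x (y + z) = omega x y + omega x z.
Hypothesis omega_alt : forall x, omega x x = 0.
Hypothesis degD : forall x y, deg (x + y) = deg x + deg y.
Hypothesis psiD : forall x y, psi (x + y) = psi x * psi y.

Lemma omegaC x y : omega y x = - omega x y.
Proof.
have := omega_alt (x + y); rewrite omegaDl !omegaDr !omega_alt addr0 add0r.
by move=> /eqP; rewrite addrC addr_eq0 => /eqP.
Qed.

Lemma omega0r x : omega x 0 = 0.
Proof. by apply: (addrI (omega x 0)); rewrite -omegaDr !addr0. Qed.

Lemma omegaNr x y : omega x (- y) = - omega x y.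
Proof. by apply: (addrI (omega x y)); rewrite -omegaDr !subrr omega0r. Qed.

Lemma omegaMr x y n : omega x (y *+ n) = n%:Z * omega x y.
Proof.
elim: n => [|n IHn]; first by rewrite omega0r mul0r.
by rewrite mulrS omegaDr IHn intS mulrDl mul1r.
Qed.

Lemma omegaMl x y n : omega (x *+ n) y = n%:Z * omega x y.
Proof. by rewrite omegaC omegaMr omegaC mulrN opprK. Qed.

Lemma degMn x n : deg (x *+ n) = n%:Z * deg x.
Proof.
elim: n => [|n IHn]; last by rewrite mulrS degD IHn intS mulrDl mul1r.
by rewrite mul0r; apply: (addrI (deg 0)); rewrite -degD !addr0.
Qed.

Lemma degB x y : deg (x - y) = deg x - deg y.
Proof. by apply: (addIr (deg y)); rewrite -degD !subrK. Qed.

(** Left multiplication by the monomial of exponent [v] and coefficient [psi v], on series with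
    coefficients [F]. As [omega] is alternating, the twist by [x - v] equals the twist by [x]. *)
Definition shift (v : A) (F : A -> C) (x : A) : C :=
  psi v * chi (omega v x) * F (x - v).

Lemma shiftD u v F x :
  shift u (shift v F) x = chi (omega u v) * shift (u + v) F x.
Proof.
rewrite /shift psiD omegaDl chiD omegaDr omegaNr (omegaC u v) opprK chiD.
by rewrite opprD addrA; ring.
Qed.

Hypothesis psi0 : psi 0 = 1.

Lemma shift0 F x : shift 0 F x = F x.
Proof. by rewrite /shift psi0 omegaC omega0r oppr0 chi0 subr0 !mul1r. Qed.

Definition supported (F : A -> C) := forall x, deg x < 0 -> F x = 0.

Lemma shift_eq0 F v x : supported F -> deg x < deg v -> shift v F x = 0.
Proof. by move=> sF xv; rewrite /shift sF ?mulr0 // degB subr_lt0. Qed.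

(* The series is truncated at [n = |deg x|]: the other terms vanish when [F] is
   supported in nonnegative degrees and [deg f.2 > 0]. *)
Definition dil (f : bool * A) (F : A -> C) (x : A) : C :=
  \sum_(n < `|deg x|.+1) Psi_coef q f.1 n * shift (f.2 *+ n) F x.

(** The [n]-th shift raises degrees by at least [n], so beyond [deg x] every term reads [F] in
    negative degrees. Hence products can share one truncation bound. *)
Lemma dilE f F x N : 0 < deg f.2 -> supported F -> deg x < N%:Z ->
  dil f F x = \sum_(n < N) Psi_coef q f.1 n * shift (f.2 *+ n) F x.
Proof.
move=> f0 sF xN; pose g n := Psi_coef q f.1 n * shift (f.2 *+ n) F x.
have g0 (n : nat) : deg x < n%:Z -> g n = 0.
  move=> xn; rewrite /g shift_eq0 ?mulr0 // degMn.
  by rewrite (lt_le_trans xn) // ler_peMr // -gtz0_ge1.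
have gx (n : nat) : (`|deg x|.+1 <= n)%N -> g n = 0.
  move=> xn; apply: g0; apply: le_lt_trans (ler_norm _) _.
  by rewrite -abszE ltz_nat.
have gN (n : nat) : (N <= n)%N -> g n = 0.
  by move=> Nn; apply: g0; rewrite (lt_le_trans xN).
have [le|/ltnW le] := leqP N `|deg x|.+1; first exact: sum_ord_widen le gN.
by rewrite /dil -(sum_ord_widen le gx).
Qed.

Lemma dil_supported f F : 0 < deg f.2 -> supported F -> supported (dil f F).
Proof.
(* In negative degree the bound 0 is admissible and leaves an empty sum. *)
by move=> f0 sF x x0; rewrite (@dilE _ _ _ 0) ?big_ord0.
Qed.

Lemma shift_dil v f F x N : 0 < deg f.2 -> supported F -> deg x < N%:Z ->
  0 <= deg v ->
  shift v (dil f F) x =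
  \sum_(n < N) Psi_coef q f.1 n * chi (omega v (f.2 *+ n))
     * shift (v + f.2 *+ n) F x.
Proof.
move=> f0 sF xN v0; rewrite {1}/shift (@dilE _ _ _ N) //; last first.
  by rewrite degB (le_lt_trans _ xN) // gerBl.
rewrite mulr_sumr; apply: eq_bigr => n _.
by rewrite mulrCA -mulrA -shiftD.
Qed.

Lemma dil2E f g F x N : 0 < deg f.2 -> 0 < deg g.2 -> supported F ->
  deg x < N%:Z ->
  dil f (dil g F) x = \sum_(n < N) \sum_(m < N)
     Psi_coef q f.1 n * Psi_coef q g.1 m
       * chi (omega (f.2 *+ n) (g.2 *+ m)) * shift (f.2 *+ n + g.2 *+ m) F x.
Proof.
move=> f0 g0 sF xN; rewrite (@dilE _ _ _ N) //; last exact: dil_supported.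
apply: eq_bigr => n _; rewrite (@shift_dil _ _ _ _ N) //; last first.
  by rewrite degMn mulr_ge0 // ltW.
by rewrite mulr_sumr; apply: eq_bigr => m _; rewrite !mulrA.
Qed.

Lemma dilC f g F : omega f.2 g.2 = 0 -> 0 < deg f.2 -> 0 < deg g.2 ->
  supported F -> dil f (dil g F) = dil g (dil f F).
Proof.
move=> fg0 f0 g0 sF; apply/funext => x.
have xN : deg x < `|deg x|.+1 by rewrite -addn1 PoszD ltzD1 abszE ler_norm.
rewrite !(dil2E _ _ _ xN) // exchange_big; apply: eq_bigr => n _.
apply: eq_bigr => m _.
rewrite !(omegaMr, omegaMl) (omegaC f.2) fg0 oppr0 !mulr0.
by rewrite (addrC (f.2 *+ m)) (mulrC (Psi_coef q f.1 m)).
Qed.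

Lemma Psi_coef_inv_bool e n :
  \sum_(k < n.+1) Psi_coef q e (n - k) * Psi_coef q (~~ e) k = (n == 0)%:R.
Proof.
have qn0 := cexp_neq0 hbar.
case: e; first exact: Psi_coef_inv.
(* Reversing the summation index swaps the two factors. *)
rewrite -(Psi_coef_inv qn0 q_generic) (reindex_inj rev_ord_inj) /=.
apply: eq_bigr => k _; rewrite subSS subKn 1?mulrC // -ltnS.
exact: ltn_ord.
Qed.

Lemma dilK e v F : 0 < deg v -> supported F ->
  dil (e, v) (dil (~~ e, v) F) = F.
Proof.
move=> v0 sF; apply/funext => x.
have xN : deg x < `|deg x|.+1 by rewrite -addn1 PoszD ltzD1 abszE ler_norm.
rewrite (dil2E _ _ _ xN) //=; set N := `|deg x|.+1 in xN *.
pose G n := shift (v *+ n) F x.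
have G0 n : (N <= n)%N -> G n = 0.
  move=> Nn; apply: shift_eq0 => //; rewrite degMn (lt_le_trans xN) //.
  by rewrite (@le_trans _ _ n%:Z) // ler_peMr // -gtz0_ge1.
under eq_bigr => n _ do under eq_bigr => m _ do
  rewrite omegaMl omegaMr omega_alt !mulr0 chi0 mulr1 -mulrnDr -/(G _).
rewrite exchange_big /=.
(* Multiples of [v] commute, so the shift depends on the total multiplicity only. That becomes the
   new [n], and the inner sum over [m] is the one in [Psi_coef_inv_bool]. *)
transitivity (\sum_(m < N) \sum_(n < N | (m <= n)%N)
    Psi_coef q e (n - m) * Psi_coef q (~~ e) m * G n).
  apply: eq_bigr => m _.
  rewrite -(sum_ord_shift (g := fun n =>
    Psi_coef q e (n - m) * Psi_coef q (~~ e) m * G n)).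
  2: by move=> i /G0 ->; rewrite mulr0.
  by apply: eq_bigr => n _; rewrite addnK.
rewrite (exchange_big_dep predT) //=.
transitivity (\sum_(n < N) (n == 0%N :> nat)%:R * G n).
  apply: eq_bigr => n _; rewrite -mulr_suml; congr (_ * _).
  rewrite -(Psi_coef_inv_bool e).
  by rewrite (big_ord_widen N (fun k =>
       Psi_coef q e (n - k) * Psi_coef q (~~ e) k)).
rewrite big_ord_recl big1 => [|i _]; last by rewrite mul0r.
by rewrite mul1r addr0 /G mulr0n shift0.
Qed.

(** As [chi 4 = q ^+ 2], the condition [omega u v = 2] encodes [U V = q^2 V U]. Both sides are
    compared at each total exponent [i u + j v], where [Psi_coef_pentagon] applies. *)
Lemma dil_pentagon u v F : omega u v = 2 -> 0 < deg u -> 0 < deg v ->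
  supported F ->
  dil (true, u) (dil (true, v) F)
  = dil (true, v) (dil (true, u + v) (dil (true, u) F)).
Proof.
move=> uv u0 v0 sF; apply/funext => x.
have xN : deg x < `|deg x|.+1 by rewrite -addn1 PoszD ltzD1 abszE ler_norm.
have w0 : 0 < deg (u + v) by rewrite degD addr_gt0.
have suF := @dil_supported (true, u) F u0 sF.
rewrite !(dil2E _ _ _ xN) //=; set N := `|deg x|.+1 in xN *.
pose a n := Psi_coef q true n.
pose G i j := shift (u *+ i + v *+ j) F x.
have G0 i j : (N <= i + j)%N -> G i j = 0.
  move=> Nn; apply: shift_eq0 => //; rewrite degD !degMn (lt_le_trans xN) //.
  rewrite (@le_trans _ _ (i%:Z + j%:Z)) // lerD // ler_peMr // -gtz0_ge1 //.
(* The coefficient on the right-hand side for total exponent [i u + j v] with [k] copies of [u + v];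
   merging the monomials produces [chi] at [- 2 (i * j - k * k)]. *)
pose c i j k := a (i - k)%N * a (j - k)%N * a k * q ^+ (k * k)
  * chi (- (2 * (i * j)%:Z)).
have T j k : shift (v *+ j + (u + v) *+ k) (dil (true, u) F) x
    = \sum_(i < N) a i * chi (- (2 * ((j + k) * i)%:Z)) * G (i + k)%N (j + k)%N.
  rewrite (@shift_dil _ _ _ _ N) //=; last first.
    by rewrite degD !degMn addr_ge0 ?mulr_ge0 // ltW.
  apply: eq_bigr => i _; congr (_ * chi _ * shift _ _ _).
    rewrite omegaDl omegaMl omegaMr omegaMl omegaMr omegaDl omega_alt.
    by rewrite (omegaC u v) uv PoszM PoszD; ring.
  rewrite mulrnDl !mulrnDr [RHS]addrC -!addrA; congr (_ + _).
  by rewrite addrCA (addrC (u *+ k)).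
transitivity (\sum_(i < N) \sum_(j < N) \sum_(k < N | (k <= i)%N && (k <= j)%N)
   c i j k * G i j).
  apply: eq_bigr => i _; apply: eq_bigr => j _.
  rewrite -!mulr_suml Psi_coef_pentagon ?cexp_neq0 //; congr (_ * _).
  rewrite -[RHS]mulrA; congr (_ * _).
  rewrite -exprM -chi2 -chiD omegaMl omegaMr uv; congr chi.
  by rewrite !PoszM; ring.
transitivity (\sum_(k < N) \sum_(j < N | (k <= j)%N) \sum_(i < N | (k <= i)%N)
   c i j k * G i j).
  rewrite exchange_big /= [RHS](exchange_big_dep predT) //=.
  apply: eq_bigr => j _.
  rewrite (exchange_big_dep (fun k : 'I_N => (k <= j)%N)) //=.
    by apply: eq_bigr => k kj; apply: eq_bigl => i; rewrite kj andbT.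
  by move=> i k _ /andP[].
rewrite [RHS]exchange_big; apply: eq_bigr => k _ /=.
rewrite -(sum_ord_shift (g := fun j => \sum_(i < N | (k <= i)%N)
   c i j k * G i j)); last first.
  move=> j Nj; rewrite big1 // => i _; rewrite G0 ?mulr0 //.
  by rewrite (leq_trans Nj) ?leq_addl.
apply: eq_bigr => j _.
rewrite -(sum_ord_shift (g := fun i =>
   c i (j + k)%N k * G i (j + k)%N)); last first.
  by move=> i Ni; rewrite G0 ?mulr0 // (leq_trans Ni) ?leq_addr.
rewrite T mulr_sumr; apply: eq_bigr => i _.
rewrite /c !addnK -!/(a _) -chi2.
have -> : chi (omega (v *+ j) ((u + v) *+ k)) = chi (- (2 * (j * k)%:Z)).
  congr chi; rewrite omegaMl omegaMr omegaDr omega_alt (omegaC u v) uv.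
  by rewrite PoszM; ring.
have -> : chi (- (2 * ((i + k) * (j + k))%:Z))
   = chi (- (2 * (j * k)%:Z)) * chi (- (2 * ((j + k) * i)%:Z))
     * chi (- (2 * (k * k)%:Z)).
  by rewrite -!chiD; congr chi; rewrite !(PoszM, PoszD); ring.
have : chi (2 * (k * k)%:Z) * chi (- (2 * (k * k)%:Z)) = 1.
  by rewrite -chiD subrr chi0.
set c1 := chi (2 * _); set c2 := chi (- (2 * (k * k)%:Z)) => c12.
rewrite -[RHS]mulr1 -c12; move: (G _ _) (a i) (a j) (a k) => ? ? ? ?; ring.
Qed.

(** * Words of dilogarithm operators *)

Definition op (l : seq (bool * A)) (F : A -> C) : A -> C := foldr dil F l.

Definition posw (l : seq (bool * A)) := all (fun f => 0 < deg f.2) l.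

Definition opeq (l l' : seq (bool * A)) :=
  forall F, supported F -> op l F = op l' F.

Lemma op_cat l l' F : op (l ++ l') F = op l (op l' F).
Proof. by rewrite /op foldr_cat. Qed.

Lemma op_supported l F : posw l -> supported F -> supported (op l F).
Proof.
elim: l => //= f l IHl /andP[f0 l0] sF.
by apply: dil_supported => //; apply: IHl.
Qed.

Lemma opeq_trans l1 l2 l3 : opeq l1 l2 -> opeq l2 l3 -> opeq l1 l3.
Proof. by move=> e12 e23 F sF; rewrite e12 ?e23. Qed.

Lemma opeq_cat l1 l2 l l' : posw l2 -> opeq l l' ->
  opeq (l1 ++ l ++ l2) (l1 ++ l' ++ l2).
Proof. by move=> p2 ll' F sF; rewrite !op_cat ll' //; apply: op_supported. Qed.

Definition invw (l : seq (bool * A)) := rev [seq (~~ f.1, f.2) | f <- l].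

Lemma op_invK l F : posw l -> supported F -> op (invw l) (op l F) = F.
Proof.
elim: l F => //= -[e v] l IHl F /andP[v0 l0] sF.
rewrite /invw /= rev_cons -cats1 op_cat /= -[in RHS](IHl F l0 sF).
congr op; rewrite -{2}[e]negbK dilK //.
exact: op_supported.
Qed.

(** Applying the hypothesis to [op l' F] makes [invw l'] cancel, so it suffices to reduce a single
    word. *)
Lemma opeq_inv l l' : posw l -> posw l' ->
  opeq (l ++ invw l') [::] -> opeq l l'.
Proof.
move=> p p' ll' F sF; rewrite -[RHS]ll' ?op_cat ?op_invK //.
exact: op_supported.
Qed.

(** The flag [s] records the sign of [omega]. Letters of equal sign expand into three only if that
    sign is [s]; letters of opposite signs do so in either order, the new letter having sign
    [~~ s]. *)
Lemma opeq_pentagon (a b : bool * A) (s : bool) :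
  omega a.2 b.2 = (if s then 2 else - 2) -> 0 < deg a.2 -> 0 < deg b.2 ->
  (a.1 = b.1 -> a.1 = s) ->
  opeq [:: a; b]
    (let c := (if a.1 == b.1 then a.1 else ~~ s, a.2 + b.2) in
     if a.1 == b.1 then [:: b; c; a]
     else if a.1 == s then [:: c; b; a] else [:: b; a; c]).
Proof.
have supp x e F : 0 < deg x -> supported F -> supported (dil (e, x) F).
  by move=> x0; apply: dil_supported.
have degDp x y : 0 < deg x -> 0 < deg y -> 0 < deg (x + y).
  by move=> x0 y0; rewrite degD addr_gt0.
case: a b => [e u] [f v] /= uv u0 v0 es F sF.
have w0 := degDp _ _ u0 v0.
case: s uv es => uv es.
  pose U e := dil (e, u); pose V e := dil (e, v); pose W e := dil (e, u + v).
  case: e f es => [] [] //= es; try by have := es erefl.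
  - exact: dil_pentagon.
  - by apply: (pentagon_np_front (S := supported) (U := U) (V := V) (W := W))
      => // *; by [apply: supp | apply: dilK | apply: dil_pentagon].
  - by apply: (pentagon_np_back (S := supported) (U := U) (V := V) (W := W))
      => // *; by [apply: supp | apply: dilK | apply: dil_pentagon].
have vu : omega v u = 2 by rewrite omegaC uv opprK.
rewrite addrC in w0 *.
pose U e := dil (e, v); pose V e := dil (e, u); pose W e := dil (e, v + u).
case: e f es => [] [] //= es; try by have := es erefl.
- by apply: (pentagon_pn_back (S := supported) (U := U) (V := V) (W := W))
    => // *; by [apply: supp | apply: dilK | apply: dil_pentagon].
- by apply: (pentagon_pn_front (S := supported) (U := U) (V := V) (W := W))
    => // *; by [apply: supp | apply: dilK | apply: dil_pentagon].
- by apply: (pentagon_nn (S := supported) (U := U) (V := V) (W := W))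
    => // *; by [apply: supp | apply: dilK | apply: dil_pentagon].
Qed.

(** * Rewriting of words with encoded exponents *)

Section Codes.
Variables (code : eqType) (ev : code -> A).
Variables (codeD : code -> code -> code) (codew : code -> code -> int).
Hypothesis evD : forall x y, ev (codeD x y) = ev x + ev y.
Hypothesis omega_ev : forall x y, omega (ev x) (ev y) = codew x y.
Local Notation letter := (bool * code)%type.

Definition evw (w : seq letter) := [seq (f.1, ev f.2) | f <- w].

Definition posc (w : seq letter) := all (fun f => 0 < deg (ev f.2)) w.

Lemma posw_ev w : posw (evw w) = posc w.
Proof. by rewrite /posw all_map. Qed.

(** Positivity is carried along, so that in a chain of rewritings it has to be checked for the
    initial word only. *)
Definition wordeq (w w' : seq letter) :=
  posc w -> posc w' /\ opeq (evw w) (evw w').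

Lemma wordeq_trans w1 w2 w3 : wordeq w1 w2 -> wordeq w2 w3 -> wordeq w1 w3.
Proof.
move=> e12 e23 /e12[p2 o12]; have [p3 o23] := e23 p2.
by split=> //; apply: opeq_trans o23.
Qed.

Lemma wordeq_cat w1 w2 w w' : wordeq w w' ->
  wordeq (w1 ++ w ++ w2) (w1 ++ w' ++ w2).
Proof.
move=> ww'; rewrite /wordeq /posc !all_cat => /and3P[-> /ww'[p' o] p2].
split; first exact/and3P.
rewrite /evw !map_cat; apply: opeq_cat => //.
by rewrite posw_ev.
Qed.

Arguments wordeq_cat w1 w2 {w w'} _ _.

Lemma wordeq_swap a b : codew a.2 b.2 = 0 -> wordeq [:: a; b] [:: b; a].
Proof.
move=> ab0 /and3P[a0 b0 _]; rewrite /posc /= a0 b0; split=> // F sF /=.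
by rewrite dilC //= omega_ev.
Qed.

Lemma wordeq_cancel a b : b.2 = a.2 -> b.1 != a.1 -> wordeq [:: a; b] [::].
Proof.
move=> ba nab /and3P[a0 _ _]; split=> // F sF /=.
have -> : b.1 = ~~ a.1 by case: (b.1) nab; case: (a.1).
by rewrite ba dilK.
Qed.

Definition commutes (a : letter) (w : seq letter) :=
  all (fun c => codew a.2 c.2 == 0) w.

Lemma wordeq_commutes a w : commutes a w -> wordeq (a :: w) (w ++ [:: a]).
Proof.
elim: w => [|b w IHw] //= /andP[/eqP ab0 aw].
apply: (@wordeq_trans _ (b :: a :: w)).
  exact: (wordeq_cat [::] w (wordeq_swap ab0)).
by have := wordeq_cat [:: b] [::] (IHw aw); rewrite !cats0.
Qed.

Fixpoint cancel_letter (a : letter) (w : seq letter) : option (seq letter) :=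
  if w isn't b :: w' then None else
  if (b.2 == a.2) && (b.1 != a.1) then Some w' else
  if codew a.2 b.2 == 0 then omap (cons b) (cancel_letter a w') else None.

Lemma wordeq_cancel_letter a w w' :
  cancel_letter a w = Some w' -> wordeq (a :: w) w'.
Proof.
elim: w w' => [|b w IHw] w' //=.
case: ifP => [/andP[/eqP ba nab] [<-]|_].
  exact: (wordeq_cat [::] w (wordeq_cancel ba nab)).
case: eqP => // ab0; case E: cancel_letter => [w1|] //= [<-].
apply: (@wordeq_trans _ (b :: a :: w)).
  exact: (wordeq_cat [::] w (wordeq_swap ab0)).
by have := wordeq_cat [:: b] [::] (IHw _ E); rewrite !cats0.
Qed.

Definition reduce : seq letter -> seq letter :=
  foldr (fun a w => odflt (a :: w) (cancel_letter a w)) [::].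

Lemma wordeq_reduce w : wordeq w (reduce w).
Proof.
elim: w => [|a w IHw] //=.
apply: (@wordeq_trans _ (a :: reduce w)).
  by have := wordeq_cat [:: a] [::] IHw; rewrite !cats0.
by case E: cancel_letter => [w'|] //=; apply: wordeq_cancel_letter.
Qed.

(** Pairs which no pentagon expands into three letters are returned unchanged, so [wordeq_exchange]
    needs no side condition and any list of moves is sound. *)
Definition exchange (a b : letter) : seq letter :=
  let s := codew a.2 b.2 == 2 in
  let c := (if a.1 == b.1 then a.1 else ~~ s, codeD a.2 b.2) in
  if ~~ (s || (codew a.2 b.2 == - 2)) || (a.1 == b.1) && (a.1 != s)
  then [:: a; b]
  else if a.1 == b.1 then [:: b; c; a]
  else if a.1 == s then [:: c; b; a] else [:: b; a; c].

Lemma wordeq_exchange a b : wordeq [:: a; b] (exchange a b).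
Proof.
rewrite /exchange; case: ifP => // /negbT.
set s := _ == 2; rewrite negb_or negbK negb_and negbK => /andP[sE ss].
move=> /and3P[a0 b0 _].
have c0 : 0 < deg (ev (codeD a.2 b.2)) by rewrite evD degD addr_gt0.
split; first by do 2?case: ifP => _; rewrite /posc /= a0 b0 c0.
have os : omega (ev a.2) (ev b.2) = (if s then 2 else - 2).
  by rewrite omega_ev; move: sE; rewrite /s; case: eqP => //= _ /eqP.
have ss' : a.1 = b.1 -> a.1 = s.
  by move=> e; move: ss; rewrite e eqxx => /eqP.
have := @opeq_pentagon (a.1, ev a.2) (b.1, ev b.2) s os a0 b0 ss'.
by rewrite /= -evD; case: (a.1 == b.1); case: (a.1 == s).
Qed.

(* Moves the [i]-th letter past the next [k] ones and exchanges it with the one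
   after that. *)
Definition move_exchange (ik : nat * nat) (w : seq letter) : seq letter :=
  if drop ik.1 w isn't a :: w1 then w else
  if drop ik.2 w1 isn't b :: w2 then w else
  if commutes a (take ik.2 w1)
  then reduce (take ik.1 w ++ take ik.2 w1 ++ exchange a b ++ w2) else w.

Lemma wordeq_move_exchange ik w : wordeq w (move_exchange ik w).
Proof.
rewrite /move_exchange; case E1: (drop ik.1 w) => [|a w1] //.
case E2: (drop ik.2 w1) => [|b w2] //; case: ifP => // am.
set m := take ik.2 w1 in am *; set w0 := take ik.1 w.
have -> : w = w0 ++ (a :: m) ++ b :: w2.
  by rewrite -(cat_take_drop ik.1 w) E1 -{1}(cat_take_drop ik.2 w1) E2.
apply: (@wordeq_trans _ (w0 ++ (m ++ [:: a]) ++ b :: w2)).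
  exact: (wordeq_cat w0 (b :: w2) (wordeq_commutes am)).
apply: (@wordeq_trans _ (w0 ++ m ++ exchange a b ++ w2)).
  rewrite -catA -[[:: a] ++ _]/([:: a; b] ++ w2) !(catA w0 m).
  exact: (wordeq_cat (w0 ++ m) w2 (@wordeq_exchange a b)).
exact: wordeq_reduce.
Qed.

Lemma wordeq_moves iks w :
  wordeq w (foldl (fun w ik => move_exchange ik w) w iks).
Proof.
elim: iks w => [|ik iks IHiks] w //=.
exact: wordeq_trans (@wordeq_move_exchange ik w) (IHiks _).
Qed.

End Codes.

End Dilogarithms.

(** * Expansion coefficients *)

Lemma big_cons_tuple (V : nmodType) (I : finType) n (P : pred (n.+1.-tuple I))
    (F : n.+1.-tuple I -> V) :
  \sum_(t | P t) F t =
  \sum_i \sum_(t : n.-tuple I | P (cons_tuple i t)) F (cons_tuple i t).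
Proof.
rewrite pair_big_dep.
rewrite (reindex (fun p : I * n.-tuple I => cons_tuple p.1 p.2)) //.
exists (fun t => (thead t, behead_tuple t)) => [[i t] _|t _] /=.
  by congr pair; apply: val_inj.
by rewrite [RHS]tuple_eta; apply: val_inj.
Qed.

Section Expansions.
Variables (R : realType) (hbar : R[i]).
Local Notation C := R[i].
Local Notation q := (cexp hbar).
Local Notation A := ('cV[int]_6 * 'cV[int]_6)%type.
Hypothesis q_generic : forall n : nat, (0 < n)%N -> q ^+ n != 1.

(** The symplectic form of the commutation relations, as it occurs in [mono_mul]. *)
Definition sform (x y : A) : int := dot x.1 y.2 - dot x.2 y.1.

Lemma sformDl x y z : sform (x + y) z = sform x z + sform y z.
Proof. by rewrite /sform /= !dotDl opprD addrACA. Qed.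

Lemma sformDr x y z : sform x (y + z) = sform x y + sform x z.
Proof. by rewrite /sform /= !dotDr opprD addrACA. Qed.

Lemma sform_alt x : sform x x = 0.
Proof. by rewrite /sform dotC subrr. Qed.

Variables (deg : A -> int) (psi : A -> C).
Hypothesis degD : forall x y, deg (x + y) = deg x + deg y.
Hypothesis psiD : forall x y, psi (x + y) = psi x * psi y.
Hypothesis psi0 : psi 0 = 1.

Definition exponent (X : monomial R) : A := (mexu X, mexw X).

Definition mono_of (x : A) : monomial R := Monomial (psi x) x.1 x.2.

Definition monos (w : seq (bool * A)) : seq (bool * monomial R) :=
  [seq (f.1, mono_of f.2) | f <- w].

Local Notation term w ns := (prod_term hbar (monos w) ns).

Lemma exponent_cons f w n ns :
  exponent (term (f :: w) (n :: ns)) = f.2 *+ n + exponent (term w ns).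
Proof.
by rewrite /exponent /=; case: f.2 => p r /=; congr pair;
   rewrite (raddfMn fst, raddfMn snd).
Qed.

Lemma psiMn x n : psi (x *+ n) = psi x ^+ n.
Proof. by elim: n => [|n IHn]; rewrite ?psi0 // mulrS psiD IHn exprS. Qed.

Lemma mcoef_cons f w n ns :
  mcoef (term (f :: w) (n :: ns))
  = Psi_coef q f.1 n * psi (f.2 *+ n)
    * chi hbar (sform (f.2 *+ n) (exponent (term w ns))) * mcoef (term w ns).
Proof.
rewrite /= /chi /sform /= -psiMn !(raddfMn fst, raddfMn snd) /=.
by rewrite mulrAC.
Qed.

(** Every letter has degree at least 1, so the degree of a product bounds all multiplicities. This
    leaves finitely many terms for each exponent. *)
Lemma deg_term w ns : posw deg w ->
  0 <= deg (exponent (term w ns)) /\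
  (size ns = size w -> all (fun n => n%:Z <= deg (exponent (term w ns))) ns).
Proof.
have d0 : deg 0 = 0 by apply: (addrI (deg 0)); rewrite -degD !addr0.
elim: w ns => [|f w IHw] [|n ns] //=; rewrite ?d0 //.
move=> /andP[f0 /(IHw ns)[s0 sn]].
have -> := exponent_cons f w n ns; rewrite degD (degMn degD).
have n0 : n%:Z <= n%:Z * deg f.2 by rewrite ler_peMr // -gtz0_ge1.
split; first by rewrite addr_ge0 // (le_trans _ n0).
case=> /sn /allP sns; rewrite (le_trans n0) ?lerDl //=.
apply/allP => m /sns; move/le_trans; apply.
by rewrite lerDr (le_trans _ n0).
Qed.

Definition delta (x : A) : C := (x == 0)%:R.

Lemma delta_supported : supported deg delta.
Proof.
have d0 : deg 0 = 0 by apply: (addrI (deg 0)); rewrite -degD !addr0.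
by move=> x; rewrite /delta; case: eqP => // ->; rewrite d0 ltxx.
Qed.

Local Notation opl := (op hbar sform deg psi).

(** The outermost [dil] chooses the multiplicity of the first letter and its shift passes the
    remaining exponent on; at the end [delta] selects the terms whose exponent is exactly [x]. *)
Lemma op_delta w x N : posw deg w -> deg x < N%:Z ->
  opl w delta x =
  \sum_(t : (size (monos w)).-tuple 'I_N |
        exponent (term w [seq val i | i <- t]) == x)
     mcoef (term w [seq val i | i <- t]).
Proof.
elim: w x => [|f w IHw] x /=.
  move=> _ _; rewrite big_mkcond (big_pred1 [tuple]) => [|t].
    by rewrite /delta /exponent /= -[(0, 0)]/(0 : A) eq_sym; case: eqP.
  by rewrite [t]tuple0; apply/esym/eqP.
move=> /andP[f0 w0] xN.
rewrite (@dilE _ hbar _ sform deg psi degD f _ x N f0 _ xN); last first.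
  exact: op_supported delta_supported.
rewrite (big_cons_tuple (n := size (monos w))); apply: eq_bigr => n _.
rewrite {1}/shift IHw //; last first.
  rewrite (degB degD) (le_lt_trans _ xN) // gerBl (degMn degD) mulr_ge0 //.
  exact: ltW.
have consE (t : (size (monos w)).-tuple 'I_N) :
  [seq val i | i <- cons_tuple n t] = val n :: [seq val i | i <- t] by [].
rewrite !mulr_sumr; apply: eq_big => [t|t /eqP tx].
  by rewrite consE exponent_cons eq_sym subr_eq eq_sym addrC.
(* [shift] twists by [x], the product of monomials by the exponent [x - f.2 *+ n] of the remaining
   factors; they agree because the form is alternating. *)
rewrite consE mcoef_cons tx sformDr.
rewrite (omegaNr sformDr) sform_alt oppr0 addr0.
by rewrite !mulrA.
Qed.

Definition bounded_tuples n N : seq (n.-tuple nat) :=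
  [seq map_tuple val t | t <- enum {: n.-tuple 'I_N.+1}].

Lemma terms_at_bounded w x (ns : (size (monos w)).-tuple nat) N :
  posw deg w -> deg x < N.+1%:Z -> exponent (term w ns) = x ->
  ns \in bounded_tuples _ N.
Proof.
move=> w0 xN ex; have [_ le_deg] := deg_term ns w0.
have ns_le n : n \in tval ns -> (n < N.+1)%N.
  have sz : size ns = size w by rewrite size_tuple size_map.
  by move/(allP (le_deg sz)); rewrite ex -ltz_nat => /le_lt_trans; apply.
apply/mapP; exists (map_tuple inord ns); first by rewrite mem_enum.
apply: val_inj; rewrite /= -map_comp -[LHS]map_id.
apply/eq_in_map => n /ns_le nN.
by rewrite /= inordK.
Qed.

Lemma terms_atE w p r ns :
  @terms_at R hbar (monos w) p r ns <-> exponent (term w ns) = (p, r).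
Proof. by split=> [[ep er]|[ep er]]; [rewrite /exponent ep er | split]. Qed.

Lemma lt_absz_succ (m : int) : m < `|m|.+1%:Z.
Proof. by rewrite -addn1 PoszD ltzD1 abszE ler_norm. Qed.

Lemma expandable_monos w : posw deg w -> expandable hbar (monos w).
Proof.
move=> w0 p r.
apply: sub_finite_set (finite_seq (bounded_tuples _ `|deg (p, r)|)).
by move=> ns /terms_atE; apply: terms_at_bounded => //; apply: lt_absz_succ.
Qed.

Lemma expansion_op w p r : posw deg w ->
  expansion hbar (monos w) p r = opl w delta (p, r).
Proof.
move=> w0; rewrite (op_delta w0 (lt_absz_succ _)) /expansion.
have -> : @terms_at R hbar (monos w) p r
    = [set` [pred ns : (size (monos w)).-tuple nat
              | exponent (term w ns) == (p, r)]]%classic.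
  by apply/seteqP; split=> ns h; [exact/eqP/terms_atE | exact/terms_atE/eqP].
(* The sum over an infinite type becomes one over a duplicate-free list containing every tuple that
   contributes. *)
rewrite -(bigfs _ (r := bounded_tuples _ `|deg (p, r)|)); last 2 first.
- rewrite map_inj_uniq ?enum_uniq // => t u.
  by move=> /(congr1 val)/(inj_map val_inj)/val_inj.
- move=> ns /eqP ex /negP[]; apply: terms_at_bounded ex => //.
  exact: lt_absz_succ.
by rewrite big_map big_enum_cond.
Qed.

End Expansions.

(** * The adjoint action *)

(** Vectors given by sequences can be evaluated by computation; missing entries count as 0. *)
Definition vec6 (K : nmodType) (s : seq K) : 'cV[K]_6 := \col_i s`_i.

Lemma vec6D (K : nmodType) (s t : seq K) :
  vec6 s + vec6 t = vec6 (mkseq (fun m => s`_m + t`_m) 6).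
Proof. by apply/matrixP => m n; rewrite !mxE nth_mkseq. Qed.

Lemma dot_vec6 (K : pzRingType) (s t : seq K) :
  dot (vec6 s) (vec6 t) = \sum_(m < 6) s`_m * t`_m.
Proof. by rewrite /dot mxE; apply: eq_bigr => m _; rewrite !mxE. Qed.

Lemma vec6_col (K : nmodType) (x : 'cV[K]_6) :
  x = vec6 (mkseq (fun m => x (inord m) 0) 6).
Proof.
by apply/matrixP => m n; rewrite !mxE nth_mkseq // inord_val (ord1 n).
Qed.

Lemma map_mx_intz m n (M : 'M[int]_(m, n)) : map_mx intr M = M.
Proof. by apply/matrixP => i j; rewrite mxE intz. Qed.

Section Transvections.
Variable K : comPzRingType.

Lemma transvection_mul (m : int) (i l : 'I_6) (x : 'cV[K]_6) :
  map_mx intr (1%:M + m *: delta_mx i l : 'M[int]_6) *m x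
  = \col_a (x a 0 + (a == i)%:R * m%:~R * x l 0).
Proof.
apply/matrixP => a b; rewrite map_mxD map_mxZ map_mx1 map_delta_mx.
rewrite mulmxDl mul1mx -scalemxAl !mxE (ord1 b) {b}; congr (_ + _).
rewrite (bigD1 l) //= big1 ?addr0 => [|c cl]; last first.
  by rewrite !mxE (negbTE cl) andbF mul0r.
by rewrite !mxE eqxx andbT; ring.
Qed.

End Transvections.

(** The matrix unit [delta_mx i l] squares to zero for [i != l], so inversion only changes the sign
    of [m]. *)
Lemma dual_transvection (m : int) (i l : 'I_6) : i != l ->
  dual (1%:M + m *: delta_mx i l) = 1%:M - m *: delta_mx l i.
Proof.
move=> il; set M := _ + _.
have M1 : M *m (1%:M - m *: delta_mx i l) = 1%:M.
  rewrite /M mulmxBr mulmx1 mulmxDl mul1mx -scalemxAl -scalemxAr mul_delta_mx_0.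
    by rewrite !scaler0 addr0 addrK.
  by rewrite eq_sym.
have uM : M \in unitmx by case/mulmx1_unit: M1.
rewrite /dual; have -> : invmx M = 1%:M - m *: delta_mx i l.
  by rewrite -[RHS](mulKmx uM) M1 mulmx1.
by rewrite linearB linearZ /= trmx1 trmx_delta.
Qed.

(** * Normal form of the operators [Pop] *)

Section Pop.
Variables (R : realType) (hbar : R[i]) (Pi Pj Pk : param R) (i j k : 'I_6).
Hypotheses (ij : i != j) (ik : i != k) (jk : j != k).
Local Notation C := R[i].
Local Notation P := (Pop hbar Pi Pj Pk i j k).

Definition Plin : 'M[int]_6 :=
  (1%:M + 1 *: delta_mx i k) *m (1%:M + (-1) *: delta_mx i j).

Lemma N6lin_Pop : N6lin (semiN P) = Plin.
Proof.
by rewrite /= !exp_uwE /= ?mulmx1 // eq_sym.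
Qed.

(** In [Pop] the exponential in [w] already stands to the left of the one in [u], so no scalar
    arises. *)
Lemma N6scal_Pop : N6scal (semiN P) = 1.
Proof.
rewrite /= !exp_uwE 1?eq_sym //=.
by rewrite !(mulmx0, addr0, dot0l, dot0r, mul0r, cexp0, mulr1).
Qed.

Lemma N6w_Pop : N6w (semiN P) =
  cmx R Plin *m (lam0 Pj Pk *: (- delta_mx i 0 - delta_mx j 0 + delta_mx k 0)).
Proof.
rewrite /= !exp_uwE 1?eq_sym //=.
by rewrite !(mulmx0, addr0, add0r).
Qed.

Lemma N6u_Pop : N6u (semiN P) =
  cmx R (dual Plin) *m (lam1 Pj Pk *: delta_mx i 0
     + lam2 Pi Pj Pk *: delta_mx j 0 + lam3 Pi Pj Pk *: delta_mx k 0).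
Proof.
rewrite /= !exp_uwE 1?eq_sym //=.
by rewrite !(mulmx0, addr0, add0r, mulmx1).
Qed.

Lemma Plin_mul (K : comPzRingType) (x : 'cV[K]_6) :
  map_mx intr Plin *m x = \col_m (x m 0 + (m == i)%:R * (x k 0 - x j 0)).
Proof.
rewrite /Plin map_mxM -mulmxA !transvection_mul; apply/matrixP => a b.
by rewrite !mxE [k == i]eq_sym (negbTE ik) /=; ring.
Qed.

Lemma dual_Plin_mul (K : comPzRingType) (x : 'cV[K]_6) :
  map_mx intr (dual Plin) *m x
  = \col_m (x m 0 + ((m == j)%:R - (m == k)%:R) * x i 0).
Proof.
rewrite /Plin dualM ?unitmxE ?det_elementary 1?eq_sym //.
rewrite !dual_transvection // -!scaleNr map_mxM -mulmxA !transvection_mul.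
by apply/matrixP => a b; rewrite !mxE (negbTE ij) /= rmorphN /=; ring.
Qed.

End Pop.

(** * Action of the semidirect product on exponents *)

Section SemidirectAction.
Variables (R : realType) (hbar : R[i]).
Local Notation C := R[i].
Local Notation semi := (semi hbar).

(** The ring is left open because the same action is needed on integral exponents of monomials and
    on complex exponents of group elements. *)
Definition actw (K : comPzRingType) (g : semi) (x : 'cV[K]_6) : 'cV[K]_6 :=
  map_mx intr (N6lin (semiN g)) *m perm_vec (semiS g) x.
Definition actu (K : comPzRingType) (g : semi) (x : 'cV[K]_6) : 'cV[K]_6 :=
  map_mx intr (dual (N6lin (semiN g))) *m perm_vec (semiS g) x.

Lemma map_perm_mat (K : pzRingType) s (M : 'M[int]_6) :
  map_mx intr (perm_mat s M) = perm_mat s (map_mx intr M) :> 'M[K]_6.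
Proof. by apply/matrixP => a b; rewrite !mxE. Qed.

Lemma actwM (K : comPzRingType) g h (x : 'cV[K]_6) :
  actw (g * h)%g x = actw g (actw h x).
Proof.
rewrite /actw /= map_mxM -mulmxA; congr (_ *m _).
by rewrite -perm_vecM perm_mat_vec map_perm_mat.
Qed.

Lemma actuM (K : comPzRingType) g h (x : 'cV[K]_6) :
  actu (g * h)%g x = actu g (actu h x).
Proof.
rewrite /actu /= dualM ?N6unit //; last first.
  by rewrite unitmxE det_perm_mat N6det unitr1.
rewrite perm_dual ?N6unit // map_mxM -mulmxA; congr (_ *m _).
by rewrite -perm_vecM perm_mat_vec map_perm_mat.
Qed.

Lemma actw_cmx g (x : 'cV[int]_6) : actw g (cmx R x) = cmx R (actw g x).
Proof.
by rewrite /actw /cmx map_mxM map_mx_intz; congr (_ *m _); apply: perm_cmx.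
Qed.

Lemma actu_cmx g (x : 'cV[int]_6) : actu g (cmx R x) = cmx R (actu g x).
Proof.
by rewrite /actu /cmx map_mxM map_mx_intz; congr (_ *m _); apply: perm_cmx.
Qed.

Lemma dot_act g (x y : 'cV[C]_6) : dot (actu g x) (actw g y) = dot x y.
Proof. by rewrite /actu /actw (dot_dual _ _ (N6unit _)) dot_perm. Qed.

Lemma N6w_mul (g h : semi) :
  N6w (semiN (g * h)%g) = N6w (semiN g) + actw g (N6w (semiN h)).
Proof. by []. Qed.

Lemma N6u_mul (g h : semi) :
  N6u (semiN (g * h)%g) = N6u (semiN g) + actu g (N6u (semiN h)).
Proof. by []. Qed.

Lemma N6scal_mul (g h : semi) :
  N6scal (semiN (g * h)%g) = N6scal (semiN g) * N6scal (semiN h)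
    * cexp (dot (N6u (semiN g)) (actw g (N6w (semiN h))) / hbar).
Proof. by []. Qed.

Lemma AdE g X : Ad g X = Monomial
  (mcoef X * cexp (dot (N6u (semiN g)) (cmx R (actw g (mexw X)))
                   - dot (N6w (semiN g)) (cmx R (actu g (mexu X)))))
  (actu g (mexu X)) (actw g (mexw X)).
Proof. by rewrite /Ad /actw /actu !map_mx_intz. Qed.

(** [N6w] and [N6u] are additive along products up to the action, and [dot_act] keeps the pairing
    invariant, so the logarithms of the coefficients add up. *)
Lemma AdM (g h : semi) X : Ad (g * h)%g X = Ad g (Ad h X).
Proof.
rewrite !AdE N6w_mul N6u_mul !actwM !actuM; congr Monomial.
rewrite -[RHS]mulrA -cexpD; congr (_ * cexp _); rewrite !dotDl.
rewrite -!(actw_cmx g) -!(actu_cmx g) dot_act [dot (actw _ _) _]dotC dot_act.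
by rewrite (dotC (cmx R _)) /=; ring.
Qed.

Lemma Ad1 X : @Ad R hbar 1%g X = X.
Proof.
case: X => m p r; rewrite /Ad /= dual1 !mul1mx !dot0l subr0 cexp0 mulr1.
by congr Monomial; apply/matrixP => a b; rewrite !mxE invg1 perm1.
Qed.

(** The linear part is recovered from its action on the standard basis; comparing actions avoids
    multiplying matrices. *)
Lemma semiP (g h : semi) :
  semiS g = semiS h -> N6scal (semiN g) = N6scal (semiN h) ->
  N6w (semiN g) = N6w (semiN h) -> N6u (semiN g) = N6u (semiN h) ->
  (forall x : 'cV[int]_6, actw g x = actw h x) -> g = h.
Proof.
case: g h => [n s] [m t] /= st escal ew eu eact; rewrite -st {t st} in eact *.
congr Semi; apply: N6P => //; apply/matrixP => a b.
have := eact (perm_vec s^-1 (delta_mx b 0)); rewrite /actw /= !map_mx_intz.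
rewrite perm_vecM mulVg /perm_vec invg1 row_perm1 -!colE.
by move=> /matrixP/(_ a 0); rewrite !mxE.
Qed.

End SemidirectAction.

(** * The action of [Pop] in coordinates *)

Section PopAction.
Variables (R : realType) (hbar : R[i]) (Pi Pj Pk : param R) (i j k : 'I_6).
Hypotheses (ij : i != j) (ik : i != k) (jk : j != k).
Local Notation C := R[i].
Local Notation P := (Pop hbar Pi Pj Pk i j k).

Definition actw_seq (K : zmodType) (i j k : nat) (s : seq K) : seq K :=
  mkseq (fun m => if m == i then s`_i + (s`_j - s`_k) else
                  if m == j then s`_k else if m == k then s`_j else s`_m) 6.

Definition actu_seq (K : zmodType) (i j k : nat) (s : seq K) : seq K :=
  mkseq (fun m => if m == j then s`_k + s`_i else
                  if m == k then s`_j - s`_i else s`_m) 6.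

Lemma perm_vec6 (K : zmodType) (s : seq K) m :
  perm_vec (tperm j k) (vec6 s) m 0
  = (if m == j then s`_k else if m == k then s`_j else s`_m).
Proof. by rewrite !mxE tpermV permE /=; case: eqP => // _; case: eqP. Qed.

Lemma actw_Pop (K : comPzRingType) (s : seq K) :
  actw P (vec6 s) = vec6 (actw_seq i j k s).
Proof.
have E (a b : 'I_6) : (nat_of_ord a == nat_of_ord b) = (a == b) by [].
rewrite /actw N6lin_Pop // Plin_mul //; apply/matrixP => m n.
rewrite [LHS]mxE !perm_vec6 [RHS]mxE nth_mkseq // !E !eqxx.
rewrite (eq_sym k) (negbTE jk).
case: (eqVneq m i) => [->|_]; first by rewrite (negbTE ij) (negbTE ik) mul1r.
by rewrite mul0r addr0.
Qed.

Lemma actu_Pop (K : comPzRingType) (s : seq K) :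
  actu P (vec6 s) = vec6 (actu_seq i j k s).
Proof.
have E (a b : 'I_6) : (nat_of_ord a == nat_of_ord b) = (a == b) by [].
rewrite /actu N6lin_Pop // dual_Plin_mul //; apply/matrixP => m n.
rewrite [LHS]mxE !perm_vec6 [RHS]mxE nth_mkseq // !E (negbTE ij) (negbTE ik).
case: (eqVneq m j) => [->|_]; first by rewrite (negbTE jk) subr0 mul1r.
by case: eqP => _; rewrite ?subrr ?sub0r ?mulN1r ?mul0r ?addr0.
Qed.

(** Exponents of the normal form: moving the linear part of [Pop] to the right turns
    [- w_i - w_j + w_k] into [w_i - w_j + w_k], and [u_i] into [u_i + u_j - u_k]. *)
Definition w_seq : seq C :=
  mkseq (fun m => lam0 Pj Pk * ((m == i)%:R - (m == j)%:R + (m == k)%:R)) 6.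

Definition u_seq : seq C :=
  mkseq (fun m => lam1 Pj Pk * ((m == i)%:R + (m == j)%:R - (m == k)%:R)
    + lam2 Pi Pj Pk * (m == j)%:R + lam3 Pi Pj Pk * (m == k)%:R) 6.

Lemma N6w_Pop_vec6 : N6w (semiN P) = vec6 w_seq.
Proof.
have E (a b : 'I_6) : (nat_of_ord a == nat_of_ord b) = (a == b) by [].
rewrite N6w_Pop // Plin_mul //; apply/matrixP => m n.
rewrite !mxE nth_mkseq // !E !eqxx !andbT.
rewrite (eq_sym k i) (eq_sym k j) (eq_sym j i).
by rewrite (negbTE ij) (negbTE ik) (negbTE jk) /=; ring.
Qed.

Lemma N6u_Pop_vec6 : N6u (semiN P) = vec6 u_seq.
Proof.
have E (a b : 'I_6) : (nat_of_ord a == nat_of_ord b) = (a == b) by [].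
rewrite N6u_Pop // dual_Plin_mul //; apply/matrixP => m n.
rewrite !mxE nth_mkseq // !E !eqxx !andbT (negbTE ij) (negbTE ik) /=.
ring.
Qed.

Lemma Ad_Pop (c : C) (p r : seq int) :
  Ad P (Monomial (cexp c) (vec6 p) (vec6 r)) =
  Monomial (cexp (c + (\sum_(m < 6) u_seq`_m * ((actw_seq i j k r)`_m)%:~R
                      - \sum_(m < 6) w_seq`_m * ((actu_seq i j k p)`_m)%:~R)))
    (vec6 (actu_seq i j k p)) (vec6 (actw_seq i j k r)).
Proof.
have int_sum (s : seq C) (t : seq int) :
    dot (vec6 s) (cmx R (vec6 t)) = \sum_(m < 6) s`_m * (t`_m)%:~R.
  by rewrite /dot mxE; apply: eq_bigr => m _; rewrite !mxE.
rewrite AdE N6w_Pop_vec6 N6u_Pop_vec6 [mexw _]/= [mexu _]/= [mcoef _]/=.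
by rewrite actw_Pop actu_Pop !int_sum -cexpD.
Qed.

End PopAction.

(** * Reduction to the empty word *)

Definition code : eqType := (seq int * seq int)%type.

(** Exponents of the sixteen factors once the group elements stand on the right; [lhs_dilog] and
    [rhs_dilog] verify both lists. *)
Definition lhs_word : seq (bool * code) :=
  [:: (false, ([:: 1; 0; 0; 1; 0; 0], [:: 1; -1; 0; 1; 0; 0]));
      (false, ([:: 1; 0; 0; -1; 0; 0], [:: 1; -1; 0; 1; 0; 0]));
      (true, ([:: 1; 0; 0; -1; 0; 0], [:: -1; 1; 0; -1; 0; 0]));
      (true, ([:: 1; 2; 0; -1; 0; 0], [:: -1; 1; 0; -1; 0; 0]));
      (false, ([:: 1; 1; 0; -1; 1; 0], [:: 1; 0; -1; 0; 1; 0]));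
      (false, ([:: 1; 1; 0; -1; -1; 0], [:: 1; 0; -1; 0; 1; 0]));
      (true, ([:: 1; 1; 0; -1; -1; 0], [:: -1; 0; 1; 0; -1; 0]));
      (true, ([:: 1; 1; 2; -1; -1; 0], [:: -1; 0; 1; 0; -1; 0]));
      (false, ([:: 0; 0; 0; 1; 0; 1], [:: 0; 0; 0; 1; -1; 1]));
      (false, ([:: 0; 0; 0; 1; 0; -1], [:: 0; 0; 0; 1; -1; 1]));
      (true, ([:: 0; 0; 0; 1; 0; -1], [:: 0; 0; 0; -1; 1; -1]));
      (true, ([:: 0; 0; 0; 1; 2; -1], [:: 0; 0; 0; -1; 1; -1]));
      (false, ([:: 0; 1; 0; 0; 1; 0], [:: 0; 1; -1; -1; 1; 0]));
      (false, ([:: 0; 1; 0; 0; -1; 0], [:: 0; 1; -1; -1; 1; 0]));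
      (true, ([:: 0; 1; 0; 0; -1; 0], [:: 0; -1; 1; 1; -1; 0]));
      (true, ([:: 0; 1; 2; 0; -1; 0], [:: 0; -1; 1; 1; -1; 0]))]%Z.

Definition rhs_word : seq (bool * code) :=
  [:: (false, ([:: 0; 0; 0; 1; 0; 1], [:: 0; 0; 0; 1; -1; 1]));
      (false, ([:: 0; 0; 0; 1; 0; -1], [:: 0; 0; 0; 1; -1; 1]));
      (true, ([:: 0; 0; 0; 1; 0; -1], [:: 0; 0; 0; -1; 1; -1]));
      (true, ([:: 0; 0; 0; 1; 2; -1], [:: 0; 0; 0; -1; 1; -1]));
      (false, ([:: 0; 1; 0; 0; 1; 0], [:: 0; 1; -1; -1; 1; 0]));
      (false, ([:: 0; 1; 0; 0; -1; 0], [:: 0; 1; -1; -1; 1; 0]));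
      (true, ([:: 0; 1; 0; 0; -1; 0], [:: 0; -1; 1; 1; -1; 0]));
      (true, ([:: 0; 1; 2; 0; -1; 0], [:: 0; -1; 1; 1; -1; 0]));
      (false, ([:: 1; 0; 0; 0; 0; 1], [:: 1; -1; 0; 2; -1; 1]));
      (false, ([:: 1; 0; 0; 0; 0; -1], [:: 1; -1; 0; 2; -1; 1]));
      (true, ([:: 1; 0; 0; 0; 0; -1], [:: -1; 1; 0; -2; 1; -1]));
      (true, ([:: 1; 0; 0; 0; 2; -1], [:: -1; 1; 0; -2; 1; -1]));
      (false, ([:: 1; 0; 0; 1; 2; -2], [:: 1; -1; 0; 1; 0; 0]));
      (false, ([:: 1; 0; 0; -1; 0; 0], [:: 1; -1; 0; 1; 0; 0]));
      (true, ([:: 1; 0; 0; -1; 0; 0], [:: -1; 1; 0; -1; 0; 0]));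
      (true, ([:: 1; 2; 2; -1; -2; 0], [:: -1; 1; 0; -1; 0; 0]))]%Z.

Definition codeD (x y : code) : code :=
  (mkseq (fun m => x.1`_m + y.1`_m) 6, mkseq (fun m => x.2`_m + y.2`_m) 6).

Definition codew (x y : code) : int :=
  foldr (fun m s => x.1`_m * y.2`_m - x.2`_m * y.1`_m + s) 0 (iota 0 6).

Definition invc (w : seq (bool * code)) := rev [seq (~~ f.1, f.2) | f <- w].

(* Found by computer search; every pair performs one pentagon. *)
Definition pentagon_moves : seq (nat * nat) :=
  [:: (11, 1); (7, 5); (14, 2); (15, 0); (9, 0); (6, 2); (11, 0); (2, 5);
      (15, 1); (14, 0); (13, 2); (12, 0); (7, 0); (4, 1); (3, 1); (3, 0)]%N.

Lemma pentagon_moves_reduce :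
  foldl (fun w ik => move_exchange codeD codew ik w)
    (reduce codew (lhs_word ++ invc rhs_word)) pentagon_moves = [::].
Proof. by vm_compute. Qed.

Definition ev (x : code) : 'cV[int]_6 * 'cV[int]_6 := (vec6 x.1, vec6 x.2).

Lemma evD x y : ev (codeD x y) = ev x + ev y.
Proof. by rewrite /ev; congr pair; rewrite /= vec6D. Qed.

Lemma sform_ev x y : sform (ev x) (ev y) = codew x y.
Proof.
rewrite /sform !dot_vec6 -sumrB /codew /= !big_ord_recl big_ord0 /=.
by [].
Qed.

(* A linear form which is positive on all exponents of both sides. *)
Definition wdeg (x : 'cV[int]_6 * 'cV[int]_6) : int :=
  2 * x.1 i1 0 + x.1 i2 0 + x.1 i4 0.

Lemma wdegD x y : wdeg (x + y) = wdeg x + wdeg y.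
Proof. by rewrite /wdeg !mxE; ring. Qed.

Lemma wdeg_ev x : wdeg (ev x) = 2 * x.1`_0 + x.1`_1 + x.1`_3.
Proof. by rewrite /wdeg !mxE. Qed.

Lemma lhs_pos : posw wdeg (evw ev lhs_word).
Proof. by rewrite /posw all_map /= !wdeg_ev. Qed.

Lemma rhs_pos : posw wdeg (evw ev rhs_word).
Proof. by rewrite /posw all_map /= !wdeg_ev. Qed.

(** The rewriting looks at exponents only, so one computation serves every character [psi]. *)
Lemma opeq_lhs_rhs (R : realType) (hbar : R[i]) psi :
  (forall n : nat, (0 < n)%N -> cexp hbar ^+ n != 1) ->
  (forall x y, psi (x + y) = psi x * psi y) -> psi 0 = 1 ->
  opeq hbar sform wdeg psi (evw ev lhs_word) (evw ev rhs_word).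
Proof.
move=> q_generic psiD psi0.
apply: (opeq_inv q_generic sformDl sformDr sform_alt wdegD psiD psi0).
- exact: lhs_pos.
- exact: rhs_pos.
have -> : evw ev lhs_word ++ invw (evw ev rhs_word)
    = evw ev (lhs_word ++ invc rhs_word) by [].
have pos : posc wdeg ev (lhs_word ++ invc rhs_word).
  by rewrite /posc /= !wdeg_ev.
have red := wordeq_reduce q_generic sformDl sformDr sform_alt wdegD psiD psi0 
  sform_ev.
have moves := wordeq_moves q_generic sformDl sformDr sform_alt wdegD psiD psi0 
  evD sform_ev.
have [pos' o1] := red _ pos; have [_ o2] := moves pentagon_moves _ pos'.
by apply: (opeq_trans o1); move: o2; rewrite pentagon_moves_reduce.
Qed.

(** * The two sides of the tetrahedron equation *)

Section Tetrahedron.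
Variables (R : realType) (hbar : R[i]) (P : 'I_6 -> param R).
Local Notation C := R[i].

(* The coefficients of the monomials of both sides are linear functions of their
   exponents; [kappa] solves the resulting linear system. *)
Definition kappa_u : seq C :=
  [seq pe (P m) / 2%:R | m <- [:: i1; i2; i3; i4; i5; i6]].

Definition kappa_w : seq C :=
  [:: - pd (P i1) - pc (P i2) - pb (P i4) - (pe (P i1) + pe (P i4)) / 2%:R; 0;
      pd (P i2) + pc (P i3) + pa (P i4) + pb (P i5)
        + (pe (P i2) + pe (P i5)) / 2%:R;
      0; 0;
      - pd (P i4) - pc (P i5) - pb (P i6) - (pe (P i4) + pe (P i6)) / 2%:R].

Definition kappa (x : 'cV[int]_6 * 'cV[int]_6) : C :=
  dot (vec6 kappa_u) (cmx R x.1) + dot (vec6 kappa_w) (cmx R x.2).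

Lemma kappaD x y : kappa (x + y) = kappa x + kappa y.
Proof. by rewrite /kappa /cmx !map_mxD !dotDr addrACA. Qed.

Definition psi x : C := cexp (kappa x).

Lemma psiD x y : psi (x + y) = psi x * psi y.
Proof. by rewrite /psi kappaD cexpD. Qed.

Lemma psi_0 : psi 0 = 1.
Proof. by rewrite /psi /kappa /cmx !map_mx0 !dot0r addr0 cexp0. Qed.

Lemma kappa_ev (x : code) : kappa (ev x) =
  \sum_(m < 6) kappa_u`_m * (x.1`_m)%:~R
  + \sum_(m < 6) kappa_w`_m * (x.2`_m)%:~R.
Proof.
by rewrite /kappa /dot !mxE; congr (_ + _); apply: eq_bigr => m _; rewrite !mxE.
Qed.

Definition mono_seqs (i j k : nat) (m : int) : code :=
  (mkseq (fun a => (a == i)%:R + m * (a == k)%:R) 6,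
   mkseq (fun a => (a == i)%:R - (a == j)%:R + (a == k)%:R) 6).

(* [(c, x)] encodes the monomial [e^(c + x.1 . u + x.2 . w)]. *)
Definition vmono (x : C * code) : monomial R :=
  Monomial (cexp x.1) (vec6 x.2.1) (vec6 x.2.2).

Definition vmonos (l : seq (bool * (C * code))) : seq (bool * monomial R) :=
  [seq (f.1, vmono f.2) | f <- l].

Definition Rpre (Pi Pj Pk : param R) i j k : seq (bool * (C * code)) :=
  [:: (false, (- pd Pi - pc Pj - pb Pk, mono_seqs i j k 1));
      (false, (- pd Pi - pc Pj - pb Pk - pe Pk, mono_seqs i j k (-1)))].

Definition Rpost (Pi Pj Pk : param R) i j k : seq (bool * (C * code)) :=
  [:: (true, (- pb Pi - pa Pj - pd Pk - pe Pk, mono_seqs i j k (-1)));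
      (true, (- pb Pi - pa Pj - pd Pk, mono_seqs i j k 1))].

(** Mirrors [Ad] on encoded monomials. Keeping the logarithm of the coefficient makes the later
    comparison one of linear expressions in the parameters. *)
Definition Ad_code (Pi Pj Pk : param R) (i j k : 'I_6) (x : C * code)
    : C * code :=
  let p := actu_seq i j k x.2.1 in let r := actw_seq i j k x.2.2 in
  (x.1 + (\sum_(m < 6) (u_seq Pi Pj Pk i j k)`_m * (r`_m)%:~R
          - \sum_(m < 6) (w_seq Pj Pk i j k)`_m * (p`_m)%:~R), (p, r)).

Definition AdW (g : semi hbar) (l : seq (bool * monomial R)) :=
  [seq (f.1, Ad g f.2) | f <- l].

(** Since [Ad] is multiplicative, a prefix [g] can be applied after normalising the rest; this
    allows treating the operators one by one from the right. *)
Lemma normal_form_Ad (g : semi hbar) ws :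
  normal_form g ws = (AdW g (dilog_part ws), (g * group_part ws)%g).
Proof.
rewrite /dilog_part /group_part; elim: ws g => [|[e Y|h] ws IHws] g /=.
- by rewrite mulg1.
- by rewrite IHws /= Ad1.
rewrite mul1g !(IHws (_ * _)%g) (IHws h) /= mulgA; congr pair.
by rewrite /AdW -map_comp; apply: eq_map => -[e X]; rewrite /= AdM.
Qed.

Lemma normal_form_Rop (Pi Pj Pk : param R) (i j k : 'I_6) ws :
  let P := Pop hbar Pi Pj Pk i j k in
  normal_form 1%g (Rop hbar Pi Pj Pk i j k ++ ws)
  = (vmonos (Rpre Pi Pj Pk i j k)
       ++ AdW P (vmonos (Rpost Pi Pj Pk i j k) ++ dilog_part ws),
     (P * group_part ws)%g).
Proof.
have E (c : C) m : Monomial (cexp c) (delta_mx i 0 + m *: delta_mx k 0)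
    (delta_mx i 0 - delta_mx j 0 + delta_mx k 0) = vmono (c, mono_seqs i j k m).
  by congr Monomial; apply/matrixP => a b;
     rewrite (ord1 b) !mxE nth_mkseq // !andbT.
by rewrite /= !Ad1 mul1g normal_form_Ad /= !E.
Qed.

Lemma dilog_part_Rop (Pi Pj Pk : param R) (i j k : 'I_6) ws l :
  i != j -> i != k -> j != k -> dilog_part ws = vmonos l ->
  dilog_part (Rop hbar Pi Pj Pk i j k ++ ws)
  = vmonos (Rpre Pi Pj Pk i j k
      ++ [seq (f.1, Ad_code Pi Pj Pk i j k f.2)
         | f <- Rpost Pi Pj Pk i j k ++ l]).
Proof.
move=> ij ik jk wsl.
rewrite {1}/dilog_part normal_form_Rop wsl [in RHS]/vmonos map_cat.
apply: (congr1 (cat _)).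
rewrite -map_cat /AdW -!map_comp; apply: eq_map => -[e [c x]].
by congr pair; rewrite /vmono; exact: Ad_Pop.
Qed.

Lemma group_part_Rop (Pi Pj Pk : param R) (i j k : 'I_6) ws :
  group_part (Rop hbar Pi Pj Pk i j k ++ ws)
  = (Pop hbar Pi Pj Pk i j k * group_part ws)%g.
Proof. by rewrite {1}/group_part normal_form_Rop. Qed.

Local Notation lhs :=
    (Rop hbar (P i1) (P i2) (P i4) i1 i2 i4
     ++ Rop hbar (P i1) (P i3) (P i5) i1 i3 i5
     ++ Rop hbar (P i2) (P i3) (P i6) i2 i3 i6
     ++ Rop hbar (P i4) (P i5) (P i6) i4 i5 i6).
Local Notation rhs :=
    (Rop hbar (P i4) (P i5) (P i6) i4 i5 i6
     ++ Rop hbar (P i2) (P i3) (P i6) i2 i3 i6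
     ++ Rop hbar (P i1) (P i3) (P i5) i1 i3 i5
     ++ Rop hbar (P i1) (P i2) (P i4) i1 i2 i4).

Hypothesis sum_param0 : forall i : 'I_6,
  pa (P i) + pb (P i) + pc (P i) + pd (P i) + pe (P i) = 0.

(** Eliminating [pe] leaves identities in free parameters, which [field] can decide. *)
Lemma pe_param i : pe (P i) = - (pa (P i) + pb (P i) + pc (P i) + pd (P i)).
Proof.
apply: (addrI (pa (P i) + pb (P i) + pc (P i) + pd (P i))).
by rewrite sum_param0 subrr.
Qed.

(** Splits the comparison into exponents, settled by computation, and logarithms of coefficients,
    settled by algebra. *)
Lemma vmonos_eq l w :
  [seq (f.1, f.2.2) | f <- l] = w ->
  [seq f.2.1 | f <- l] = [seq kappa (ev f.2) | f <- w] ->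
  vmonos l = monos psi (evw ev w).
Proof.
move=> <-; elim: l => [|[e [c x]] l IHl] //= [-> /IHl] {IHl}.
by rewrite /vmonos /= => ->.
Qed.

Ltac eval_codes := repeat match goal with
  | |- context [actw_seq ?a ?b ?c ?s] =>
    let t := eval vm_compute in (actw_seq a b c s) in
    change (actw_seq a b c s) with t
  | |- context [actu_seq ?a ?b ?c ?s] =>
    let t := eval vm_compute in (actu_seq a b c s) in
    change (actu_seq a b c s) with t
  | |- context [mono_seqs ?a ?b ?c ?s] =>
    let t := eval vm_compute in (mono_seqs a b c s) in
    change (mono_seqs a b c s) with t
  end.

Ltac compare_words :=
  apply: vmonos_eq; first by [];
  cbn [map cat Rpre Rpost Ad_code fst snd lhs_word rhs_word];
  congr [:: _; _; _; _; _; _; _; _; _; _; _; _; _; _; _; _];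
  eval_codes; rewrite kappa_ev !big_ord_recl !big_ord0 /=;
  rewrite /lam1 /lam2 /lam3 /lam0 !pe_param; field.

Lemma lhs_dilog : dilog_part lhs = monos psi (evw ev lhs_word).
Proof.
(* The empty tail lets [dilog_part_Rop] treat the last operator like the others. *)
rewrite -[X in _ ++ _ ++ _ ++ X]cats0.
have E4 := @dilog_part_Rop (P i4) (P i5) (P i6) i4 i5 i6 [::] [::]
  isT isT isT erefl.
have E3 := @dilog_part_Rop (P i2) (P i3) (P i6) i2 i3 i6 _ _ isT isT isT E4.
have E2 := @dilog_part_Rop (P i1) (P i3) (P i5) i1 i3 i5 _ _ isT isT isT E3.
rewrite (@dilog_part_Rop (P i1) (P i2) (P i4) i1 i2 i4 _ _ isT isT isT E2).
by clear E2 E3 E4; compare_words.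
Qed.

Lemma rhs_dilog : dilog_part rhs = monos psi (evw ev rhs_word).
Proof.
rewrite -[X in _ ++ _ ++ _ ++ X]cats0.
have E4 := @dilog_part_Rop (P i1) (P i2) (P i4) i1 i2 i4 [::] [::]
  isT isT isT erefl.
have E3 := @dilog_part_Rop (P i1) (P i3) (P i5) i1 i3 i5 _ _ isT isT isT E4.
have E2 := @dilog_part_Rop (P i2) (P i3) (P i6) i2 i3 i6 _ _ isT isT isT E3.
rewrite (@dilog_part_Rop (P i4) (P i5) (P i6) i4 i5 i6 _ _ isT isT isT E2).
by clear E2 E3 E4; compare_words.
Qed.

(** * Equality of the group elements *)

Definition has_data (g : semi hbar) (c : C) (w u : seq C) :=
  [/\ N6scal (semiN g) = cexp (c / hbar), N6w (semiN g) = vec6 w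
    & N6u (semiN g) = vec6 u].

Lemma has_data1 : has_data 1%g 0 [::] [::].
Proof.
by split; rewrite /= ?mul0r ?cexp0 //; apply/matrixP => a b;
   rewrite !mxE nth_nil.
Qed.

(** Each product adds a Baker-Campbell-Hausdorff pairing to the logarithm of the scalar, so equality
    of scalars reduces to a polynomial identity in the parameters. *)
Lemma has_data_Pop (Pi Pj Pk : param R) (i j k : 'I_6) g c w u :
  i != j -> i != k -> j != k -> has_data g c w u ->
  has_data (Pop hbar Pi Pj Pk i j k * g)%g
    (c + \sum_(m < 6) (u_seq Pi Pj Pk i j k)`_m * (actw_seq i j k w)`_m)
    (mkseq (fun m => (w_seq Pj Pk i j k)`_m + (actw_seq i j k w)`_m) 6)
    (mkseq (fun m => (u_seq Pi Pj Pk i j k)`_m + (actu_seq i j k u)`_m) 6).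
Proof.
move=> ij ik jk [gc gw gu]; split.
- rewrite N6scal_mul N6scal_Pop // mul1r gc gw N6u_Pop_vec6 // actw_Pop //.
  by rewrite dot_vec6 -cexpD mulrDl.
- by rewrite N6w_mul gw N6w_Pop_vec6 // actw_Pop // vec6D.
- by rewrite N6u_mul gu N6u_Pop_vec6 // actu_Pop // vec6D.
Qed.

Lemma actw_Pop_mul (Pi Pj Pk : param R) (i j k : 'I_6) (g : semi hbar)
    (x : 'cV[int]_6) s :
  i != j -> i != k -> j != k -> actw g x = vec6 s ->
  actw (Pop hbar Pi Pj Pk i j k * g)%g x = vec6 (actw_seq i j k s).
Proof. by move=> ij ik jk gx; rewrite actwM gx actw_Pop. Qed.

Lemma group_parts : group_part lhs = group_part rhs.
Proof.
rewrite -[X in group_part (_ ++ _ ++ _ ++ X) = _]cats0.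
rewrite -[X in _ = group_part (_ ++ _ ++ _ ++ X)]cats0 !group_part_Rop.
have -> : group_part (hbar := hbar) [::] = 1%g by [].
have D124 g c w u :=
  @has_data_Pop (P i1) (P i2) (P i4) i1 i2 i4 g c w u isT isT isT.
have D135 g c w u :=
  @has_data_Pop (P i1) (P i3) (P i5) i1 i3 i5 g c w u isT isT isT.
have D236 g c w u :=
  @has_data_Pop (P i2) (P i3) (P i6) i2 i3 i6 g c w u isT isT isT.
have D456 g c w u :=
  @has_data_Pop (P i4) (P i5) (P i6) i4 i5 i6 g c w u isT isT isT.
have [sl wl ul] := D124 _ _ _ _ (D135 _ _ _ _ (D236 _ _ _ _
  (D456 _ _ _ _ has_data1))).
have [sr wr ur] := D456 _ _ _ _ (D236 _ _ _ _ (D135 _ _ _ _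
  (D124 _ _ _ _ has_data1))).
apply: semiP.
- rewrite /=; apply/permP => m; apply: val_inj; rewrite !permM !permE /=.
  by case: m => [[|[|[|[|[|[|]]]]]] ?].
- rewrite sl sr; congr (cexp (_ / hbar)).
  rewrite !big_ord_recl !big_ord0 /=.
  rewrite /lam1 /lam2 /lam3 /lam0 !pe_param.
  by field.
- rewrite wl wr; apply: (congr1 (@vec6 _)).
  rewrite /mkseq /= /lam1 /lam2 /lam3 /lam0 !pe_param.
  by congr [:: _; _; _; _; _; _]; field.
- rewrite ul ur; apply: (congr1 (@vec6 _)).
  rewrite /mkseq /= /lam1 /lam2 /lam3 /lam0 !pe_param.
  by congr [:: _; _; _; _; _; _]; field.
(* An arbitrary vector gets symbolic coordinates, so that both linear parts are evaluated as
   explicit sequences. *)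
- move=> x; have := vec6_col (actw (1%g : semi hbar) x).
  move: (mkseq _ 6) => s x0.
  have A124 g s :=
    @actw_Pop_mul (P i1) (P i2) (P i4) i1 i2 i4 g x s isT isT isT.
  have A135 g s :=
    @actw_Pop_mul (P i1) (P i3) (P i5) i1 i3 i5 g x s isT isT isT.
  have A236 g s :=
    @actw_Pop_mul (P i2) (P i3) (P i6) i2 i3 i6 g x s isT isT isT.
  have A456 g s :=
    @actw_Pop_mul (P i4) (P i5) (P i6) i4 i5 i6 g x s isT isT isT.
  rewrite (A124 _ _ (A135 _ _ (A236 _ _ (A456 _ _ x0)))).
  rewrite (A456 _ _ (A236 _ _ (A135 _ _ (A124 _ _ x0)))).
  apply: (congr1 (@vec6 _)); rewrite /actw_seq /mkseq /=.
  by congr [:: _; _; _; _; _; _]; ring.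
Qed.

End Tetrahedron.

Theorem theorem4p3 (R : realType) (hbar : R[i])
    (q_generic : forall n : nat, (0 < n)%N -> cexp hbar ^+ n != 1)
    (P : 'I_6 -> param R)
    (sum_param0 : forall i : 'I_6,
       pa (P i) + pb (P i) + pc (P i) + pd (P i) + pe (P i) = 0) :
  formal_eq
    (Rop hbar (P i1) (P i2) (P i4) i1 i2 i4
     ++ Rop hbar (P i1) (P i3) (P i5) i1 i3 i5
     ++ Rop hbar (P i2) (P i3) (P i6) i2 i3 i6
     ++ Rop hbar (P i4) (P i5) (P i6) i4 i5 i6)
    (Rop hbar (P i4) (P i5) (P i6) i4 i5 i6
     ++ Rop hbar (P i2) (P i3) (P i6) i2 i3 i6
     ++ Rop hbar (P i1) (P i3) (P i5) i1 i3 i5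
     ++ Rop hbar (P i1) (P i2) (P i4) i1 i2 i4).
Proof.
have psi0 := psi_0 P; have psiM := @psiD R P.
split; last exact: group_parts.
- by rewrite lhs_dilog //; exact: (expandable_monos hbar _ wdegD lhs_pos).
- by rewrite rhs_dilog //; exact: (expandable_monos hbar _ wdegD rhs_pos).
move=> p r; rewrite lhs_dilog // rhs_dilog //.
rewrite (expansion_op hbar wdegD psiM psi0 p r lhs_pos).
rewrite (expansion_op hbar wdegD psiM psi0 p r rhs_pos).
apply: (congr1 (fun F => F (p, r))).
exact: (opeq_lhs_rhs q_generic psiM psi0 (delta_supported R wdegD)).
Qed.
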